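(* $$\sum_{k=0}^\infty\frac{\binom{2k}{k}}{(2k+1)^3\, 16^k}\left(\left(\sum_{j=0}^k\frac{33}{(2j+1)^3}\right)+\frac{8}{(2k+1)^3}\right)=\frac{245}{216}\pi^3\zeta_3-\frac{49}{144}\pi\zeta_5.$$
   Context: $\zeta_n:=\sum_{i=1}^\infty \frac{1}{i^n}$ for integers $n\ge 2$. *)

(* Defs.v *)
From Stdlib Require Import Reals.
From Coquelicot Require Import Coquelicot.
Open Scope R_scope.

(* The series converges for n >= 2; the index is shifted so that it starts
   at 1 / 1 ^ n. *)
Definition zeta (n : nat) : R := Series (fun i : nat => 1 / INR (S i) ^ n).

(* Main.v *)
Require Import Defs.
From Stdlib Require Import Reals Lra Lia ZArith.
From Coquelicot Require Import Coquelicot.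
Open Scope R_scope.

(* The nonterminating form of the Gessel-Stanton summation evaluates
     sum_k (2a)_k (2b)_k (1-2b)_k (-n)_k (2a+3k)
           / (2a k! (a-b+1)_k (a+b+1/2)_k (1+2a+2n)_k 4^k)
   as a quotient of Gamma values; at a = 3/4, b = 1/4, n = -1/2 it reads
   sum_k binom(2k,k) / ((2k+1) 16^k) = pi / 3.  Perturbing the three parameters
   along a line, a = 3/4 + q s/4, b = 1/4 + b s/4, n = -1/2 - v s/2, the
   coefficient of s^5 on the left is a series whose terms are polynomials in
   1/(2k+1) and the sums of 1/(2j+1)^i over j <= k; the summand of the theorem is
   a rational combination of these coefficients for ten directions (q, b, v).

   The summation is proved by a Wilf-Zeilberger pair for a -> a + 1, carried out
   in R[s]/(s^6): the sum becomes an infinite product of rational factors, with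
   limit 1 for the remaining sum as a -> oo.  Taking logarithms, the product is
   pi/3 times the exponential of a polynomial in s with coefficients in ln 2 and
   zeta(2), ..., zeta(5).  In the final combination the ln 2 terms cancel because
   zeta(4) = 2/5 zeta(2)^2.  Wallis' product, zeta(2) and zeta(4) come from the
   moments of x^p cos(x)^n over [0, pi/2]. *)

(** * Moments of powers of the cosine *)

Definition cos_moment (p n : nat) : R :=
  RInt (fun x => x ^ p * cos x ^ n) 0 (PI / 2).

Lemma cos_moment_correct (p n : nat) :
  is_RInt (fun x => x ^ p * cos x ^ n) 0 (PI / 2) (cos_moment p n).
Proof.
apply (RInt_correct (V := R_CompleteNormedModule)).
apply (ex_RInt_continuous (V := R_CompleteNormedModule)).
intros x _; apply (ex_derive_continuous (K := R_AbsRing) (V := R_NormedModule)).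
auto_derive; auto.
Qed.

Lemma cos_moment_le (p n p' n' : nat) (a : R) :
  (forall x, 0 < x < PI / 2 -> x ^ p * cos x ^ n <= a * (x ^ p' * cos x ^ n')) ->
  cos_moment p n <= a * cos_moment p' n'.
Proof.
intros H; pose proof PI_RGT_0.
apply (is_RInt_le (fun x => x ^ p * cos x ^ n)
  (fun x => a * (x ^ p' * cos x ^ n')) 0 (PI / 2)); [lra | | | exact H].
- apply cos_moment_correct.
- apply (is_RInt_scal (V := R_NormedModule)), cos_moment_correct.
Qed.

(** Two integrations by parts, raising the power of [x] each time; the second uses that
    [sin x * cos x ^ (n + 1)] has derivative [(n + 2) * cos x ^ (n + 2) - (n + 1) * cos x ^ n]. *)
Lemma cos_moment_by_parts (p n : nat) :
  cos_moment p (S (S n)) =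
  (INR n + 2) / ((INR p + 1) * (INR p + 2))
  * ((INR n + 1) * cos_moment (S (S p)) n
     - (INR n + 2) * cos_moment (S (S p)) (S (S n))).
Proof.
pose proof (pos_INR n) as Hn; pose proof (pos_INR p) as Hp.
pose (c := (INR n + 2) / ((INR p + 1) * (INR p + 2))).
(* [F] collects the boundary terms of both integrations; it vanishes at 0 through the powers of [x]
   and at [PI / 2] through the cosine. *)
pose (F := fun x => x ^ S p / (INR p + 1) * cos x ^ S (S n)
  + c * (x ^ S (S p) * (sin x * cos x ^ S n))).
pose (g := fun x => x ^ p * cos x ^ S (S n)
  - (c * (INR n + 1) * (x ^ S (S p) * cos x ^ n)
     - c * (INR n + 2) * (x ^ S (S p) * cos x ^ S (S n)))).
assert (H1 : is_RInt g 0 (PI / 2) (F (PI / 2) - F 0)).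
{ apply (is_RInt_derive (V := R_CompleteNormedModule) F g).
  - intros x _; unfold F, g; auto_derive; [exact I |].
    change (match p with O => 1 | S _ => INR p + 1 end) with (INR (S p)).
    change (match n with O => 1 | S _ => INR n + 1 end) with (INR (S n)).
    rewrite !S_INR; simpl pow.
    assert (E : sin x * sin x = 1 - cos x * cos x).
    { pose proof (sin2_cos2 x) as E; unfold Rsqr in E; lra. }
    transitivity (x ^ p * (cos x * cos x * cos x ^ n)
      + c * (x * x * x ^ p) * (cos x * cos x * cos x ^ n
        - (INR n + 1) * (sin x * sin x) * cos x ^ n)).
    + unfold c; field; lra.
    + rewrite E; ring.
  - intros x _.
    apply (ex_derive_continuous (K := R_AbsRing) (V := R_NormedModule)).
    unfold g; auto_derive; auto. }
assert (H2 : is_RInt g 0 (PI / 2) (cos_moment p (S (S n))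
  - (c * (INR n + 1) * cos_moment (S (S p)) n
     - c * (INR n + 2) * cos_moment (S (S p)) (S (S n))))).
{ unfold g.
  apply (is_RInt_minus (V := R_NormedModule)); [apply cos_moment_correct |].
  apply (is_RInt_minus (V := R_NormedModule));
    apply (is_RInt_scal (V := R_NormedModule)), cos_moment_correct. }
apply (is_RInt_unique (V := R_CompleteNormedModule)) in H1.
apply (is_RInt_unique (V := R_CompleteNormedModule)) in H2.
rewrite H1 in H2; unfold F in H2; rewrite cos_PI2 in H2; simpl pow in H2.
fold c; lra.
Qed.

(** Integrates the derivative of [sin x * cos x ^ (n + 1)], which vanishes at both ends. *)
Lemma cos_moment_wallis (n : nat) :
  (INR n + 2) * cos_moment 0 (S (S n)) = (INR n + 1) * cos_moment 0 n.
Proof.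
pose proof (pos_INR n) as Hn.
pose (F := fun x => sin x * cos x ^ S n).
pose (g := fun x => (INR n + 2) * (x ^ 0 * cos x ^ S (S n))
  - (INR n + 1) * (x ^ 0 * cos x ^ n)).
assert (H1 : is_RInt g 0 (PI / 2) (F (PI / 2) - F 0)).
{ apply (is_RInt_derive (V := R_CompleteNormedModule) F g).
  - intros x _; unfold F, g; auto_derive; [exact I |].
    change (match n with O => 1 | S _ => INR n + 1 end) with (INR (S n)).
    rewrite S_INR; simpl pow.
    assert (E : sin x * sin x = 1 - cos x * cos x).
    { pose proof (sin2_cos2 x) as E; unfold Rsqr in E; lra. }
    transitivity (cos x * (cos x * cos x ^ n)
      - (INR n + 1) * (sin x * sin x) * cos x ^ n); [ring |].
    rewrite E; ring.
  - intros x _.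
    apply (ex_derive_continuous (K := R_AbsRing) (V := R_NormedModule)).
    unfold g; auto_derive; auto. }
assert (H2 : is_RInt g 0 (PI / 2) ((INR n + 2) * cos_moment 0 (S (S n))
  - (INR n + 1) * cos_moment 0 n)).
{ apply (is_RInt_minus (V := R_NormedModule));
    apply (is_RInt_scal (V := R_NormedModule)), cos_moment_correct. }
apply (is_RInt_unique (V := R_CompleteNormedModule)) in H1.
apply (is_RInt_unique (V := R_CompleteNormedModule)) in H2.
rewrite H1 in H2; unfold F in H2; rewrite cos_PI2, sin_0 in H2; simpl pow in H2.
lra.
Qed.

Lemma cos_moment_degree_0 (p : nat) :
  cos_moment p 0 = (PI / 2) ^ S p / (INR p + 1).
Proof.
pose proof (pos_INR p) as Hp.
pose (F := fun x => x ^ S p / (INR p + 1)).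
assert (H1 : is_RInt (fun x => x ^ p * cos x ^ 0) 0 (PI / 2) (F (PI / 2) - F 0)).
{ apply (is_RInt_derive (V := R_CompleteNormedModule) F).
  - intros x _; unfold F; auto_derive; [exact I |].
    change (match p with O => 1 | S _ => INR p + 1 end) with (INR (S p)).
    rewrite S_INR; simpl; field; lra.
  - intros x _.
    apply (ex_derive_continuous (K := R_AbsRing) (V := R_NormedModule)).
    auto_derive; auto. }
apply (is_RInt_unique (V := R_CompleteNormedModule)) in H1.
unfold cos_moment; rewrite H1; unfold F; simpl pow; field; lra.
Qed.

Lemma cos_moment_0_1 : cos_moment 0 1 = 1.
Proof.
assert (H1 : is_RInt (fun x => x ^ 0 * cos x ^ 1) 0 (PI / 2) (sin (PI / 2) - sin 0)).
{ apply (is_RInt_derive (V := R_CompleteNormedModule) sin).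
  - intros x _; auto_derive; [exact I | simpl; ring].
  - intros x _.
    apply (ex_derive_continuous (K := R_AbsRing) (V := R_NormedModule)).
    auto_derive; auto. }
apply (is_RInt_unique (V := R_CompleteNormedModule)) in H1.
unfold cos_moment; rewrite H1, sin_PI2, sin_0; ring.
Qed.

(** Wallis' recurrence makes the left side independent of [n], so its value at [n = 0] decides. *)
Lemma cos_moment_product (n : nat) :
  (INR n + 1) * (cos_moment 0 n * cos_moment 0 (S n)) = PI / 2.
Proof.
induction n as [| n IH].
- rewrite cos_moment_0_1, cos_moment_degree_0; simpl; field.
- pose proof (cos_moment_wallis n) as H; rewrite S_INR.
  replace ((INR n + 1 + 1) * (cos_moment 0 (S n) * cos_moment 0 (S (S n))))
    with (cos_moment 0 (S n) * ((INR n + 2) * cos_moment 0 (S (S n)))) by ring.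
  rewrite H, <- IH; ring.
Qed.

Lemma cos_bounds (x : R) : 0 < x < PI / 2 -> 0 < cos x <= 1.
Proof.
intros Hx; split; [apply cos_gt_0; lra | apply COS_bound].
Qed.

Lemma cos_moment_decr (p n : nat) : cos_moment p (S n) <= cos_moment p n.
Proof.
rewrite <- (Rmult_1_l (cos_moment p n)).
apply cos_moment_le; intros x Hx; destruct (cos_bounds x Hx) as [C0 C1].
simpl; rewrite Rmult_1_l.
apply Rmult_le_compat_l; [apply pow_le; lra |].
rewrite <- (Rmult_1_l (cos x ^ n)) at 2.
apply Rmult_le_compat_r; [apply pow_le |]; lra.
Qed.

Lemma cos_moment_nonneg (p n : nat) : 0 <= cos_moment p n.
Proof.
replace 0 with (0 * cos_moment p n) by ring.
assert (H : (-1) * cos_moment p n <= 0 * cos_moment p n).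
{ apply (is_RInt_le (fun x => (-1) * (x ^ p * cos x ^ n))
    (fun x => 0 * (x ^ p * cos x ^ n)) 0 (PI / 2)).
  - pose proof PI_RGT_0; lra.
  - apply (is_RInt_scal (V := R_NormedModule)), cos_moment_correct.
  - apply (is_RInt_scal (V := R_NormedModule)), cos_moment_correct.
  - intros x Hx; destruct (cos_bounds x Hx) as [C0 C1].
    assert (0 <= x ^ p * cos x ^ n)
      by (apply Rmult_le_pos; apply pow_le; lra).
    lra. }
lra.
Qed.

Lemma cos_moment_0_pos (n : nat) : 0 < cos_moment 0 n.
Proof.
pose proof (cos_moment_product n) as H; pose proof PI_RGT_0.
destruct (cos_moment_nonneg 0 n) as [| E]; [assumption |].
rewrite <- E in H; lra.
Qed.

(** The function [t * cos t - sin t] vanishes at 0 and has derivative [- (t * sin t) <= 0]. *)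
Lemma x_cos_le_sin (x : R) : 0 <= x <= PI / 2 -> x * cos x <= sin x.
Proof.
intros Hx.
assert (H : 0 * cos 0 - sin 0 >= x * cos x - sin x).
{ destruct (MVT_gen (fun t => t * cos t - sin t) 0 x
    (fun t => - (t * sin t))) as [c [Hc E]].
  - intros t _; auto_derive; [exact I | ring].
  - intros t _; apply continuity_pt_filterlim.
    change (continuous (fun t => t * cos t - sin t) t).
    apply (ex_derive_continuous (K := R_AbsRing) (V := R_NormedModule)).
    auto_derive; auto.
  - rewrite Rmin_left, Rmax_right in Hc by lra.
    assert (0 <= c * sin c * x).
    { apply Rmult_le_pos; [apply Rmult_le_pos |]; try lra.
      apply sin_ge_0; lra. }
    lra. }
rewrite sin_0 in H; lra.
Qed.

(** Squaring [x * cos x <= sin x] bounds the second moment by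
    [cos_moment 0 n - cos_moment 0 (n + 2)], which is [cos_moment 0 (n + 2) / (n + 1)] by Wallis. *)
Lemma cos_moment_2_le (n : nat) :
  (INR n + 1) * cos_moment 2 (S (S n)) <= cos_moment 0 (S (S n)).
Proof.
pose proof (cos_moment_wallis n) as W; pose proof (pos_INR n) as Hn.
assert (H : cos_moment 2 (S (S n)) <= cos_moment 0 n - cos_moment 0 (S (S n))).
{ pose proof PI_RGT_0.
  apply (is_RInt_le (fun x => x ^ 2 * cos x ^ S (S n))
    (fun x => x ^ 0 * cos x ^ n - x ^ 0 * cos x ^ S (S n)) 0 (PI / 2)); [lra | | |].
  - apply cos_moment_correct.
  - apply (is_RInt_minus (V := R_NormedModule)); apply cos_moment_correct.
  - intros x Hx; destruct (cos_bounds x Hx) as [C0 C1].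
    pose proof (x_cos_le_sin x ltac:(lra)) as J.
    pose proof (sin2_cos2 x) as E; unfold Rsqr in E.
    assert (Hc : 0 <= cos x ^ n) by (apply pow_le; lra).
    assert (0 <= x * cos x) by (apply Rmult_le_pos; lra).
    assert (S2 : (x * cos x) * (x * cos x) <= sin x * sin x)
      by (apply Rmult_le_compat; lra).
    simpl.
    replace (x * (x * 1) * (cos x * (cos x * cos x ^ n)))
      with ((x * cos x) * (x * cos x) * cos x ^ n) by ring.
    replace (1 * cos x ^ n - 1 * (cos x * (cos x * cos x ^ n)))
      with ((1 - cos x * cos x) * cos x ^ n) by ring.
    apply Rmult_le_compat_r; lra. }
apply (Rmult_le_compat_l (INR n + 1)) in H; [| lra].
lra.
Qed.

(** * The values zeta(2) and zeta(4) *)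

Fixpoint psum (f : nat -> R) (n : nat) : R :=
  match n with O => 0 | S n => psum f n + f n end.

Definition zsum (j : nat) : nat -> R := psum (fun i => 1 / INR (S i) ^ j).
Definition tsum (j : nat) : nat -> R := psum (fun i => 1 / INR (2 * i + 1) ^ j).

Lemma zsum_S (j n : nat) : zsum j (S n) = zsum j n + 1 / INR (S n) ^ j.
Proof. reflexivity. Qed.

Lemma tsum_S (j n : nat) : tsum j (S n) = tsum j n + 1 / INR (2 * n + 1) ^ j.
Proof. reflexivity. Qed.

Definition moment_ratio (p m : nat) : R :=
  cos_moment p (2 * m) / cos_moment 0 (2 * m).

(** Integration by parts divided by Wallis' recurrence becomes a telescoping difference: [p = 0]
    sums [1 / m ^ 2], and [p = 2] leads on to zeta(4). *)
Lemma moment_ratio_rec (p m : nat) :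
  moment_ratio p (S m) / INR (S m) ^ 2 =
  4 / ((INR p + 1) * (INR p + 2))
  * (moment_ratio (S (S p)) m - moment_ratio (S (S p)) (S m)).
Proof.
unfold moment_ratio.
replace (2 * S m)%nat with (S (S (2 * m))) by lia.
pose proof (pos_INR m) as Hm; pose proof (pos_INR p) as Hp.
pose proof (cos_moment_0_pos (2 * m)) as H0.
pose proof (cos_moment_wallis (2 * m)) as W.
rewrite (cos_moment_by_parts p (2 * m)).
rewrite mult_INR in *; change (INR 2) with 2 in *; rewrite S_INR.
replace (cos_moment 0 (S (S (2 * m))))
  with ((2 * INR m + 1) / (2 * INR m + 2) * cos_moment 0 (2 * m)).
- field; lra.
- apply Rmult_eq_reg_l with (2 * INR m + 2); [| lra].
  rewrite W; field; lra.
Qed.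

Lemma moment_ratio_0 (p : nat) : moment_ratio p 0 = (PI / 2) ^ p / (INR p + 1).
Proof.
pose proof (pos_INR p); pose proof PI_RGT_0.
unfold moment_ratio; simpl (2 * 0)%nat; rewrite !cos_moment_degree_0; simpl.
field; lra.
Qed.

Lemma moment_ratio_0_l (m : nat) : moment_ratio 0 m = 1.
Proof.
unfold moment_ratio; pose proof (cos_moment_0_pos (2 * m)); field; lra.
Qed.

Lemma is_lim_seq_inv_succ (c : R) : is_lim_seq (fun n => c / (INR n + 1)) 0.
Proof.
replace (Finite 0) with (Rbar_mult c (Rbar_inv p_infty))
  by (simpl; f_equal; ring).
apply is_lim_seq_scal_l with (u := fun n => / (INR n + 1)).
apply is_lim_seq_inv; [| discriminate].
apply is_lim_seq_ext with (fun n => INR (S n)); [intros n; apply S_INR |].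
apply is_lim_seq_incr_1 with (u := INR), is_lim_seq_INR.
Qed.

Lemma moment_ratio_2_lim : is_lim_seq (moment_ratio 2) 0.
Proof.
apply is_lim_seq_incr_1.
apply is_lim_seq_le_le with (fun _ => 0) (fun n => 1 / (INR n + 1)).
- intros n; unfold moment_ratio; replace (2 * S n)%nat with (S (S (2 * n))) by lia.
  pose proof (cos_moment_0_pos (S (S (2 * n)))) as H0.
  pose proof (cos_moment_nonneg 2 (S (S (2 * n)))) as H1.
  pose proof (cos_moment_2_le (2 * n)) as H2.
  rewrite mult_INR in H2; change (INR 2) with 2 in H2; pose proof (pos_INR n).
  split; [apply Rdiv_le_0_compat; lra |].
  apply Rle_div_l; [lra |].
  replace (1 / (INR n + 1) * cos_moment 0 (S (S (2 * n))))
    with (cos_moment 0 (S (S (2 * n))) / (INR n + 1)) by (field; lra).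
  apply (Rle_div_r _ _ (INR n + 1)); [lra | nra].
- apply is_lim_seq_const.
- apply is_lim_seq_inv_succ.
Qed.

Lemma moment_ratio_4_lim : is_lim_seq (moment_ratio 4) 0.
Proof.
apply is_lim_seq_le_le with (fun _ => 0) (fun n => (PI / 2) ^ 2 * moment_ratio 2 n).
- intros n; unfold moment_ratio.
  pose proof (cos_moment_0_pos (2 * n)) as H0.
  split; [apply Rdiv_le_0_compat; [apply cos_moment_nonneg | assumption] |].
  replace ((PI / 2) ^ 2 * (cos_moment 2 (2 * n) / cos_moment 0 (2 * n)))
    with ((PI / 2) ^ 2 * cos_moment 2 (2 * n) / cos_moment 0 (2 * n))
    by (unfold Rdiv; ring).
  apply Rmult_le_compat_r; [apply Rlt_le, Rinv_0_lt_compat; assumption |].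
  apply cos_moment_le; intros x Hx; destruct (cos_bounds x Hx) as [C0 C1].
  replace (x ^ 4) with (x ^ 2 * x ^ 2) by ring; rewrite Rmult_assoc.
  apply Rmult_le_compat_r.
  + apply Rmult_le_pos; apply pow_le; lra.
  + apply pow_incr; lra.
- apply is_lim_seq_const.
- replace (Finite 0) with (Rbar_mult ((PI / 2) ^ 2) 0) by (simpl; f_equal; ring).
  apply is_lim_seq_scal_l, moment_ratio_2_lim.
Qed.

Lemma zsum_2 (n : nat) : zsum 2 n = PI ^ 2 / 6 - 2 * moment_ratio 2 n.
Proof.
induction n as [| n IH].
- rewrite moment_ratio_0; unfold zsum; simpl; field.
- rewrite zsum_S, IH.
  pose proof (moment_ratio_rec 0 n) as H.
  rewrite moment_ratio_0_l in H; simpl (INR 0) in H; lra.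
Qed.

(* Summing [zsum 2 m / m ^ 2] over m <= n gives (zsum 2 n ^ 2 + zsum 4 n) / 2,
   while [moment_ratio_rec 2] makes the same sum telescope. *)
Lemma zsum_4 (n : nat) :
  zsum 4 n = PI ^ 2 / 3 * zsum 2 n - zsum 2 n ^ 2
             - 4 / 3 * (PI ^ 4 / 80 - moment_ratio 4 n).
Proof.
induction n as [| n IH].
- rewrite moment_ratio_0; unfold zsum; simpl; field.
- pose proof (moment_ratio_rec 2 n) as H.
  pose proof (zsum_2 (S n)) as Z.
  rewrite zsum_S.
  replace (moment_ratio 2 (S n)) with ((PI ^ 2 / 6 - zsum 2 (S n)) / 2) in H by lra.
  rewrite (zsum_S 2) in *.
  rewrite IH.
  replace (moment_ratio 4 (S n)) with (moment_ratio 4 n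
    - 3 * ((PI ^ 2 / 6 - (zsum 2 n + 1 / INR (S n) ^ 2)) / 2 / INR (S n) ^ 2))
    by (rewrite H; change (INR 2) with 2; field).
  field; apply not_0_INR; lia.
Qed.

Lemma zsum_2_lim : is_lim_seq (zsum 2) (PI ^ 2 / 6).
Proof.
apply is_lim_seq_ext with (fun n => PI ^ 2 / 6 - 2 * moment_ratio 2 n).
{ intros n; symmetry; apply zsum_2. }
replace (Finite (PI ^ 2 / 6)) with (Finite (PI ^ 2 / 6 - 2 * 0)) by (f_equal; ring).
apply is_lim_seq_minus'; [apply is_lim_seq_const |].
apply (is_lim_seq_scal_l _ 2 0), moment_ratio_2_lim.
Qed.

Lemma zsum_4_lim : is_lim_seq (zsum 4) (PI ^ 4 / 90).
Proof.
apply is_lim_seq_ext with (fun n => PI ^ 2 / 3 * zsum 2 n - zsum 2 n * zsum 2 n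
             - 4 / 3 * (PI ^ 4 / 80 - moment_ratio 4 n)).
{ intros n; rewrite zsum_4; ring. }
replace (PI ^ 4 / 90) with (PI ^ 2 / 3 * (PI ^ 2 / 6) - PI ^ 2 / 6 * (PI ^ 2 / 6)
             - 4 / 3 * (PI ^ 4 / 80 - 0)) by field.
apply is_lim_seq_minus'; [apply is_lim_seq_minus' |].
- apply is_lim_seq_mult'; [apply is_lim_seq_const | apply zsum_2_lim].
- apply is_lim_seq_mult'; apply zsum_2_lim.
- apply is_lim_seq_mult'; [apply is_lim_seq_const |].
  apply is_lim_seq_minus'; [apply is_lim_seq_const | apply moment_ratio_4_lim].
Qed.

(** * Limits of the partial sums over all integers and over odd integers *)

Lemma psum_sum_n (f : nat -> R) (n : nat) : psum f (S n) = sum_n f n.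
Proof.
induction n as [| n IH].
- simpl; rewrite sum_O; ring.
- rewrite sum_Sn, <- IH; reflexivity.
Qed.

Lemma is_series_psum (f : nat -> R) (l : R) :
  is_series f l <-> is_lim_seq (psum f) l.
Proof.
split; intros H.
- apply is_lim_seq_incr_1, is_lim_seq_ext with (sum_n f); [| exact H].
  intros n; symmetry; apply psum_sum_n.
- apply is_lim_seq_incr_1 in H.
  apply (is_lim_seq_ext _ (sum_n f)) in H; [exact H | apply psum_sum_n].
Qed.

Lemma ex_series_zeta (j : nat) : ex_series (fun i => 1 / INR (S i) ^ (2 + j)).
Proof.
apply (ex_series_le (K := R_AbsRing) (V := R_CompleteNormedModule)
  _ (fun i => 1 / INR (S i) ^ 2)).
- intros i; change (Rabs (1 / INR (S i) ^ (2 + j)) <= 1 / INR (S i) ^ 2).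
  assert (H : 1 <= INR (S i)) by (rewrite S_INR; pose proof (pos_INR i); lra).
  assert (H2 : 0 < INR (S i) ^ 2) by (apply pow_lt; lra).
  rewrite Rabs_pos_eq.
  + apply Rmult_le_compat_l; [lra |].
    apply Rinv_le_contravar; [exact H2 |].
    apply Rle_pow; [exact H | lia].
  + apply Rdiv_le_0_compat; [lra | apply pow_lt; lra].
- exists (PI ^ 2 / 6); apply is_series_psum, zsum_2_lim.
Qed.

Lemma zsum_lim (j : nat) : (2 <= j)%nat -> is_lim_seq (zsum j) (zeta j).
Proof.
intros Hj; apply is_series_psum.
replace j with (2 + (j - 2))%nat by lia.
apply Series_correct, ex_series_zeta.
Qed.

Lemma zeta_2 : zeta 2 = PI ^ 2 / 6.
Proof. apply is_series_unique, is_series_psum, zsum_2_lim. Qed.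

Lemma zeta_4 : zeta 4 = PI ^ 4 / 90.
Proof. apply is_series_unique, is_series_psum, zsum_4_lim. Qed.

(** Splits the denominators 1, ..., 2n into odd and even ones. *)
Lemma zsum_double (j n : nat) : zsum j (2 * n) = tsum j n + zsum j n / 2 ^ j.
Proof.
induction n as [| n IH]; [unfold zsum, tsum; simpl; unfold Rdiv; ring |].
replace (2 * S n)%nat with (S (S (2 * n))) by lia.
rewrite !zsum_S, tsum_S, IH.
replace (S (2 * n)) with (2 * n + 1)%nat by lia.
replace (INR (S (2 * n + 1))) with (2 * INR (S n))
  by (change 2 with (INR 2); rewrite <- mult_INR; f_equal; lia).
rewrite Rpow_mult_distr; unfold Rdiv; rewrite Rinv_mult.
ring.
Qed.

Lemma is_lim_seq_shift (u : nat -> R) (f : nat -> nat) (l : R) :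
  (forall n, (f n < f (S n))%nat) -> is_lim_seq u l ->
  is_lim_seq (fun n => u (f n)) l.
Proof.
intros Hf H; apply is_lim_seq_subseq with (2 := H), eventually_subseq, Hf.
Qed.

Lemma tsum_lim (j : nat) : (2 <= j)%nat ->
  is_lim_seq (tsum j) ((1 - / 2 ^ j) * zeta j).
Proof.
intros Hj.
apply is_lim_seq_ext with (fun n => zsum j (2 * n) - / 2 ^ j * zsum j n).
{ intros n; rewrite zsum_double; unfold Rdiv; ring. }
replace ((1 - / 2 ^ j) * zeta j) with (zeta j - / 2 ^ j * zeta j) by ring.
apply is_lim_seq_minus'.
- apply (is_lim_seq_shift _ (fun n => 2 * n)%nat);
    [intros; lia | apply zsum_lim, Hj].
- apply (is_lim_seq_scal_l _ (/ 2 ^ j) (zeta j)), zsum_lim, Hj.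
Qed.

(* The limit is ln 2; its value is irrelevant. *)
Lemma tsum_1_zsum_1_lim :
  exists l : R, is_lim_seq (fun n => tsum 1 n - zsum 1 n / 2) l.
Proof.
destruct (ex_series_le (K := R_AbsRing) (V := R_CompleteNormedModule)
  (fun i => 1 / INR (2 * i + 1) ^ 1 - 1 / INR (S i) ^ 1 / 2)
  (fun i => 1 / INR (S i) ^ (2 + 0))) as [l Hl].
- intros i.
  change (Rabs (1 / INR (2 * i + 1) ^ 1 - 1 / INR (S i) ^ 1 / 2)
          <= 1 / INR (S i) ^ 2).
  rewrite plus_INR, mult_INR, (S_INR i).
  change (INR 2) with 2; change (INR 1) with 1.
  pose proof (pos_INR i) as Hi; set (x := INR i) in *.
  replace (1 / (2 * x + 1) ^ 1 - 1 / (x + 1) ^ 1 / 2)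
    with (1 / ((2 * x + 1) * (2 * (x + 1)))) by (field; lra).
  assert (0 < (2 * x + 1) * (2 * (x + 1))) by nra.
  rewrite Rabs_pos_eq.
  + apply Rmult_le_compat_l; [lra |].
    apply Rinv_le_contravar; nra.
  + apply Rdiv_le_0_compat; lra.
- apply (ex_series_zeta 0).
- exists l; apply is_series_psum in Hl.
  apply is_lim_seq_ext with (2 := Hl).
  intros n; induction n as [| n IH].
  + unfold tsum, zsum; simpl; lra.
  + rewrite tsum_S, zsum_S; cbn [psum]; rewrite IH; lra.
Qed.


(** * Jets *)

(* [Jet x0 ... x5] stands for x0 + x1 s + ... + x5 s^5 in R[s]/(s^6);
   [jlin x c] is x + c s and [jinv x c] is its inverse when x <> 0. *)
Record jet := Jet { j0 : R; j1 : R; j2 : R; j3 : R; j4 : R; j5 : R }.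

Declare Scope jet_scope.
Delimit Scope jet_scope with J.
Bind Scope jet_scope with jet.

Definition jadd (x y : jet) : jet :=
  Jet (j0 x + j0 y) (j1 x + j1 y) (j2 x + j2 y)
      (j3 x + j3 y) (j4 x + j4 y) (j5 x + j5 y).
Definition jopp (x : jet) : jet :=
  Jet (- j0 x) (- j1 x) (- j2 x) (- j3 x) (- j4 x) (- j5 x).
Definition jsub (x y : jet) : jet := jadd x (jopp y).
Definition jmul (x y : jet) : jet :=
  Jet (j0 x * j0 y)
      (j0 x * j1 y + j1 x * j0 y)
      (j0 x * j2 y + j1 x * j1 y + j2 x * j0 y)
      (j0 x * j3 y + j1 x * j2 y + j2 x * j1 y + j3 x * j0 y)
      (j0 x * j4 y + j1 x * j3 y + j2 x * j2 y + j3 x * j1 y + j4 x * j0 y)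
      (j0 x * j5 y + j1 x * j4 y + j2 x * j3 y + j3 x * j2 y + j4 x * j1 y
       + j5 x * j0 y).
Definition jlin (x c : R) : jet := Jet x c 0 0 0 0.
Definition jconst (x : R) : jet := jlin x 0.
Definition jinv (x c : R) : jet :=
  Jet (/ x) (- c / x ^ 2) (c ^ 2 / x ^ 3) (- c ^ 3 / x ^ 4)
      (c ^ 4 / x ^ 5) (- c ^ 5 / x ^ 6).
Definition jnorm (x : jet) : R :=
  Rabs (j0 x) + Rabs (j1 x) + Rabs (j2 x) + Rabs (j3 x) + Rabs (j4 x)
  + Rabs (j5 x).

Infix "+" := jadd : jet_scope.
Infix "-" := jsub : jet_scope.
Infix "*" := jmul : jet_scope.
Notation "- x" := (jopp x) : jet_scope.

Lemma jet_ext (x y : jet) :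
  j0 x = j0 y -> j1 x = j1 y -> j2 x = j2 y -> j3 x = j3 y -> j4 x = j4 y ->
  j5 x = j5 y -> x = y.
Proof. destruct x, y; simpl; intros; subst; reflexivity. Qed.

Lemma jet_ring_theory :
  ring_theory (jconst 0) (jconst 1) jadd jmul jsub jopp eq.
Proof.
split; intros; try reflexivity; apply jet_ext; simpl; ring.
Qed.

Lemma jet_ring_morph :
  ring_morph (jconst 0) (jconst 1) jadd jmul jsub jopp eq
    0%Z 1%Z Z.add Z.mul Z.sub Z.opp Z.eqb (fun z => jconst (IZR z)).
Proof.
split; intros; try reflexivity.
- rewrite plus_IZR; apply jet_ext; simpl; ring.
- rewrite minus_IZR; apply jet_ext; simpl; ring.
- rewrite mult_IZR; apply jet_ext; simpl; ring.
- rewrite opp_IZR; apply jet_ext; simpl; ring.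
- apply Z.eqb_eq in H; rewrite H; reflexivity.
Qed.

Ltac jet_cst t :=
  match t with
  | jconst (IZR ?z) => match isZcst z with true => z | _ => constr:(NotConstant) end
  | _ => constr:(NotConstant)
  end.

Add Ring jet_ring : jet_ring_theory
  (morphism jet_ring_morph, constants [jet_cst]).

Lemma jconst_add (x y : R) : jconst (x + y) = (jconst x + jconst y)%J.
Proof. apply jet_ext; simpl; ring. Qed.

Lemma jconst_opp (x : R) : jconst (- x) = (- jconst x)%J.
Proof. apply jet_ext; simpl; ring. Qed.

Lemma jconst_mul (x y : R) : jconst (x * y) = (jconst x * jconst y)%J.
Proof. apply jet_ext; simpl; ring. Qed.

(** Here [jlin 0 1] is the variable s; with it isolated, [ring] sees a polynomial identity in s and
    the real parameters. *)
Lemma jlin_decomp (x c : R) : jlin x c = (jconst x + jconst c * jlin 0 1)%J.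
Proof. apply jet_ext; simpl; ring. Qed.

Ltac jlin_expand :=
  rewrite ?(jlin_decomp (_ + _)), ?(jlin_decomp (_ - _)), ?(jlin_decomp (_ * _));
  unfold Rminus;
  repeat (rewrite jconst_add || rewrite jconst_mul || rewrite jconst_opp).

Lemma jlin_inv (x c : R) : x <> 0 -> (jlin x c * jinv x c)%J = jconst 1.
Proof. intros Hx; apply jet_ext; simpl; field; assumption. Qed.

Lemma jlin_inv_pos (x c : R) : 0 < x -> (jlin x c * jinv x c)%J = jconst 1.
Proof. intros Hx; apply jlin_inv; lra. Qed.

Lemma jnorm_pos (x : jet) : 0 <= jnorm x.
Proof. unfold jnorm; repeat apply Rplus_le_le_0_compat; apply Rabs_pos. Qed.

Lemma jnorm_add (x y : jet) : jnorm (x + y) <= jnorm x + jnorm y.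
Proof.
unfold jnorm; simpl.
pose proof (Rabs_triang (j0 x) (j0 y)); pose proof (Rabs_triang (j1 x) (j1 y));
pose proof (Rabs_triang (j2 x) (j2 y)); pose proof (Rabs_triang (j3 x) (j3 y));
pose proof (Rabs_triang (j4 x) (j4 y)); pose proof (Rabs_triang (j5 x) (j5 y)).
lra.
Qed.

Lemma jnorm_mul (x y : jet) : jnorm (x * y) <= jnorm x * jnorm y.
Proof.
destruct x as [a0 a1 a2 a3 a4 a5], y as [b0 b1 b2 b3 b4 b5].
unfold jnorm; simpl.
eapply Rle_trans.
- repeat match goal with
  | |- Rabs (_ + _) <= _ => eapply Rle_trans; [apply Rabs_triang |]
  | |- Rabs (_ * _) <= _ => rewrite Rabs_mult; apply Rle_refl
  | |- _ + _ <= _ => apply Rplus_le_compat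
  end.
- pose proof (Rabs_pos a0); pose proof (Rabs_pos a1); pose proof (Rabs_pos a2);
  pose proof (Rabs_pos a3); pose proof (Rabs_pos a4); pose proof (Rabs_pos a5);
  pose proof (Rabs_pos b0); pose proof (Rabs_pos b1); pose proof (Rabs_pos b2);
  pose proof (Rabs_pos b3); pose proof (Rabs_pos b4); pose proof (Rabs_pos b5).
  apply Rminus_le_0.
  match goal with |- 0 <= ?d =>
    replace d with
      (* The products of total degree at least 6, which truncation discards. *)
      (Rabs a1 * Rabs b5 + Rabs a2 * (Rabs b4 + Rabs b5)
       + Rabs a3 * (Rabs b3 + Rabs b4 + Rabs b5)
       + Rabs a4 * (Rabs b2 + Rabs b3 + Rabs b4 + Rabs b5)
       + Rabs a5 * (Rabs b1 + Rabs b2 + Rabs b3 + Rabs b4 + Rabs b5)) by ring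
  end.
  repeat apply Rplus_le_le_0_compat; apply Rmult_le_pos; lra.
Qed.

Lemma jnorm_lin (x c : R) : jnorm (jlin x c) = Rabs x + Rabs c.
Proof. unfold jnorm; simpl; rewrite !Rabs_R0; ring. Qed.

Lemma jnorm_lin_le (x c e : R) :
  0 <= x -> Rabs c <= e -> jnorm (jlin x c) <= x + e.
Proof.
intros Hx Hc; rewrite jnorm_lin, (Rabs_pos_eq x) by assumption; lra.
Qed.

(** The inverse is a geometric series of ratio [- c s / x] cut after s^5, so its norm is at most the
    full sum [/ (x - Rabs c)]. *)
Lemma jnorm_inv_le (x c e : R) :
  Rabs c <= e -> e < x -> jnorm (jinv x c) <= / (x - e).
Proof.
intros Hc He.
pose proof (Rabs_pos c) as H0.
assert (Hx : 0 < x) by lra.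
assert (E : jnorm (jinv x c) =
  / x + Rabs c / x ^ 2 + Rabs c ^ 2 / x ^ 3 + Rabs c ^ 3 / x ^ 4
  + Rabs c ^ 4 / x ^ 5 + Rabs c ^ 5 / x ^ 6).
{ unfold jnorm, jinv; cbn [j0 j1 j2 j3 j4 j5]; unfold Rdiv.
  rewrite !Rabs_mult, !Rabs_Ropp, !Rabs_inv, <- !RPow_abs, (Rabs_pos_eq x) by lra.
  reflexivity. }
rewrite E; clear E.
set (u := Rabs c) in *.
apply Rle_trans with (/ (x - u)).
- apply Rmult_le_reg_r with (x - u); [lra |].
  rewrite Rinv_l by lra.
  replace ((/ x + u / x ^ 2 + u ^ 2 / x ^ 3 + u ^ 3 / x ^ 4 + u ^ 4 / x ^ 5
    + u ^ 5 / x ^ 6) * (x - u)) with (1 - (u / x) ^ 6) by (field; lra).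
  assert (0 <= (u / x) ^ 6) by (apply pow_le, Rdiv_le_0_compat; lra).
  lra.
- apply Rinv_le_contravar; lra.
Qed.

(** * The Wilf-Zeilberger pair *)

(* For a = 3/4 + m + q s/4, b' = 1/4 + b s/4 and n = -1/2 - v s/2, [gs_term] is
   (2a)_k (2b')_k (1-2b')_k (-n)_k (2a+3k) /
   (2a k! (a-b'+1)_k (a+b'+1/2)_k (1+2a+2n)_k 4^k),
   [gs_core] is this without the factor 2 (2a+3k), and [gs_quot] is the quotient
   of the closed forms at a and a + 1. *)
Definition gs_ratio (q b v : R) (m k : nat) : jet :=
  (jlin (4 * INR m + 2 * INR k + 3) q
   * (jlin (2 * INR k + 1) b * jlin (2 * INR k + 1) (- b)
      * jlin (2 * INR k + 1) v)
   * (jinv (2 * INR k + 2) 0 * jinv (4 * INR m + 4 * INR k + 6) (q - b)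
      * jinv (4 * INR m + 4 * INR k + 6) (q + b)
      * jinv (4 * INR m + 2 * INR k + 3) (q - 2 * v)))%J.

Fixpoint gs_core (q b v : R) (m k : nat) : jet :=
  match k with
  | O => jinv (4 * INR m + 3) q
  | S k => (gs_core q b v m k * gs_ratio q b v m k)%J
  end.

Definition gs_term (q b v : R) (m k : nat) : jet :=
  (gs_core q b v m k * jlin (4 * INR m + 6 * INR k + 3) q)%J.

Definition gs_quot (q b v : R) (m : nat) : jet :=
  (jlin (4 * INR m + 4) (q + b - 2 * v) * jlin (4 * INR m + 4) (q - b - 2 * v)
   * jlin (4 * INR m + 5) q * jlin (4 * INR m + 7) q
   * (jinv (4 * INR m + 3) (q - 2 * v) * jinv (4 * INR m + 5) (q - 2 * v)
      * jinv (4 * INR m + 6) (q + b) * jinv (4 * INR m + 6) (q - b)))%J.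

(* The term times the rational certificate
   -2k (2k+4a+2n+1) / ((2a+3k) (1+2a+2n+k)) found by Gosper's algorithm. *)
Definition gs_cert (q b v : R) (m k : nat) : jet :=
  (jconst (- 8 * INR k) * gs_core q b v m k
   * jlin (4 * INR m + 2 * INR k + 3) (q - v)
   * jinv (4 * INR m + 2 * INR k + 3) (q - 2 * v))%J.

(** Replacing a by a + 1 changes every Pochhammer symbol by a rational factor. This expresses all
    terms of the WZ equation as multiples of the same [gs_core q b v m k]. *)
Lemma gs_core_shift (q b v : R) (m k : nat) :
  (gs_quot q b v m * gs_core q b v (S m) k)%J =
  (gs_core q b v m k
   * jlin (4 * INR m + 2 * INR k + 3) q * jlin (4 * INR m + 2 * INR k + 5) q
   * jlin (4 * INR m + 4) (q + b - 2 * v) * jlin (4 * INR m + 4) (q - b - 2 * v)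
   * jinv (4 * INR m + 4 * INR k + 6) (q - b)
   * jinv (4 * INR m + 4 * INR k + 6) (q + b)
   * jinv (4 * INR m + 2 * INR k + 3) (q - 2 * v)
   * jinv (4 * INR m + 2 * INR k + 5) (q - 2 * v))%J.
Proof.
pose proof (pos_INR m) as Hm.
induction k as [| k IH]; cbn [gs_core].
- unfold gs_quot.
  pose proof (jlin_inv_pos (4 * INR m + 7) q ltac:(lra)) as H7.
  pose proof (jlin_inv_pos (4 * INR m + 3) q ltac:(lra)) as H3.
  rewrite S_INR; simpl (INR 0).
  replace (4 * (INR m + 1) + 3) with (4 * INR m + 7) by ring.
  replace (4 * INR m + 2 * 0 + 3) with (4 * INR m + 3) by ring.
  replace (4 * INR m + 2 * 0 + 5) with (4 * INR m + 5) by ring.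
  replace (4 * INR m + 4 * 0 + 6) with (4 * INR m + 6) by ring.
  transitivity
    (jlin (4 * INR m + 4) (q + b - 2 * v) * jlin (4 * INR m + 4) (q - b - 2 * v)
     * jlin (4 * INR m + 5) q
     * (jinv (4 * INR m + 3) (q - 2 * v) * jinv (4 * INR m + 5) (q - 2 * v)
        * jinv (4 * INR m + 6) (q + b) * jinv (4 * INR m + 6) (q - b))
     * (jlin (4 * INR m + 7) q * jinv (4 * INR m + 7) q))%J; [ring |].
  rewrite H7, <- H3; ring.
- transitivity
    (gs_quot q b v m * gs_core q b v (S m) k * gs_ratio q b v (S m) k)%J;
    [ring |].
  rewrite IH; unfold gs_ratio; rewrite !S_INR.
  replace (4 * (INR m + 1) + 2 * INR k + 3)
    with (4 * INR m + 2 * INR k + 7) by ring.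
  replace (4 * (INR m + 1) + 4 * INR k + 6)
    with (4 * INR m + 4 * INR k + 10) by ring.
  replace (4 * INR m + 2 * (INR k + 1) + 3)
    with (4 * INR m + 2 * INR k + 5) by ring.
  replace (4 * INR m + 2 * (INR k + 1) + 5)
    with (4 * INR m + 2 * INR k + 7) by ring.
  replace (4 * INR m + 4 * (INR k + 1) + 6)
    with (4 * INR m + 4 * INR k + 10) by ring.
  ring.
Qed.

(** After division by [gs_core] and clearing of the four denominators [D1], ..., [D4], the equation
    is a polynomial identity. *)
Lemma gs_wz (q b v : R) (m k : nat) :
  (gs_term q b v m k - gs_quot q b v m * gs_term q b v (S m) k)%J =
  (gs_cert q b v m (S k) - gs_cert q b v m k)%J.
Proof.
pose proof (pos_INR m) as Hm; pose proof (pos_INR k) as Hk.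
transitivity
  (gs_term q b v m k - gs_quot q b v m * gs_core q b v (S m) k
     * jlin (4 * INR (S m) + 6 * INR k + 3) q)%J.
{ unfold gs_term; ring. }
rewrite gs_core_shift; unfold gs_cert, gs_term; cbn [gs_core]; unfold gs_ratio.
rewrite !S_INR.
replace (4 * (INR m + 1) + 6 * INR k + 3) with (4 * INR m + 6 * INR k + 7) by ring.
replace (4 * INR m + 2 * (INR k + 1) + 3)
  with (4 * INR m + 2 * INR k + 5) by ring.
set (V := gs_core q b v m k).
pose proof (jlin_inv_pos (4 * INR m + 4 * INR k + 6) (q - b) ltac:(lra)) as H1.
pose proof (jlin_inv_pos (4 * INR m + 4 * INR k + 6) (q + b) ltac:(lra)) as H2.
pose proof (jlin_inv_pos (4 * INR m + 2 * INR k + 3) (q - 2 * v) ltac:(lra)) as H3.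
pose proof (jlin_inv_pos (4 * INR m + 2 * INR k + 5) (q - 2 * v) ltac:(lra)) as H4.
(* The factor [k + 1] of the certificate at [k + 1] cancels the one from the factorial in
   [gs_ratio]. *)
assert (H5 : (jconst (-8 * (INR k + 1)) * jinv (2 * INR k + 2) 0)%J = jconst (-4)).
{ apply jet_ext; simpl; field; lra. }
set (D1 := jlin (4 * INR m + 4 * INR k + 6) (q - b)) in *.
set (D2 := jlin (4 * INR m + 4 * INR k + 6) (q + b)) in *.
set (D3 := jlin (4 * INR m + 2 * INR k + 3) (q - 2 * v)) in *.
set (D4 := jlin (4 * INR m + 2 * INR k + 5) (q - 2 * v)) in *.
set (d1 := jinv (4 * INR m + 4 * INR k + 6) (q - b)) in *.
set (d2 := jinv (4 * INR m + 4 * INR k + 6) (q + b)) in *.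
set (d3 := jinv (4 * INR m + 2 * INR k + 3) (q - 2 * v)) in *.
set (d4 := jinv (4 * INR m + 2 * INR k + 5) (q - 2 * v)) in *.
set (d5 := jinv (2 * INR k + 2) 0) in *.
(* Each side is brought over the common denominator by inserting the missing products [D1 * d1],
   ..., [D4 * d4], all equal to 1. *)
transitivity (V * (d1 * d2 * d3 * d4)
  * (D1 * D2 * D3 * D4 * jlin (4 * INR m + 6 * INR k + 3) q
     - jlin (4 * INR m + 2 * INR k + 3) q * jlin (4 * INR m + 2 * INR k + 5) q
       * jlin (4 * INR m + 4) (q + b - 2 * v) * jlin (4 * INR m + 4) (q - b - 2 * v)
       * jlin (4 * INR m + 6 * INR k + 7) q))%J.
{ transitivity (V * jlin (4 * INR m + 6 * INR k + 3) q
    * ((D1 * d1) * (D2 * d2) * (D3 * d3) * (D4 * d4))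
    - V * (d1 * d2 * d3 * d4)
      * (jlin (4 * INR m + 2 * INR k + 3) q * jlin (4 * INR m + 2 * INR k + 5) q
       * jlin (4 * INR m + 4) (q + b - 2 * v) * jlin (4 * INR m + 4) (q - b - 2 * v)
       * jlin (4 * INR m + 6 * INR k + 7) q))%J; [rewrite H1, H2, H3, H4 |]; ring. }
transitivity (V * (d1 * d2 * d3 * d4)
  * (jconst (-4) * jlin (4 * INR m + 2 * INR k + 3) q
     * (jlin (2 * INR k + 1) b * jlin (2 * INR k + 1) (- b)
        * jlin (2 * INR k + 1) v) * jlin (4 * INR m + 2 * INR k + 5) (q - v)
     - jconst (-8 * INR k) * jlin (4 * INR m + 2 * INR k + 3) (q - v)
       * D1 * D2 * D4))%J.
- f_equal; unfold D1, D2, D3, D4; jlin_expand; ring.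
- rewrite <- H5.
  transitivity (V * (d1 * d2 * d3 * d4)
    * (jconst (-8 * (INR k + 1)) * d5 * jlin (4 * INR m + 2 * INR k + 3) q
       * (jlin (2 * INR k + 1) b * jlin (2 * INR k + 1) (- b)
        * jlin (2 * INR k + 1) v) * jlin (4 * INR m + 2 * INR k + 5) (q - v))
    - V * jconst (-8 * INR k) * jlin (4 * INR m + 2 * INR k + 3) (q - v) * d3
      * ((D1 * d1) * (D2 * d2) * (D4 * d4)))%J; [ring |].
  rewrite H1, H2, H4; ring.
Qed.

(** * Telescoping, norm estimates and the limit a -> oo *)

Lemma jnorm_mul_le (x y : jet) (a b : R) :
  jnorm x <= a -> jnorm y <= b -> jnorm (x * y) <= a * b.
Proof.
intros Ha Hb; apply Rle_trans with (1 := jnorm_mul x y).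
apply Rmult_le_compat; auto using jnorm_pos.
Qed.

Fixpoint jsum (f : nat -> jet) (n : nat) : jet :=
  match n with O => jconst 0 | S n => (jsum f n + f n)%J end.

Fixpoint jprod (f : nat -> jet) (n : nat) : jet :=
  match n with O => jconst 1 | S n => (jprod f n * f n)%J end.

Definition jlim (u : nat -> jet) (l : jet) : Prop :=
  is_lim_seq (fun n => jnorm (u n - l)) 0.

Lemma jnorm_sum_le (f : nat -> jet) (c : R) (n : nat) :
  (forall k, (k < n)%nat -> jnorm (f k) <= c) -> jnorm (jsum f n) <= INR n * c.
Proof.
induction n as [| n IH]; intros H.
- simpl jsum; unfold jconst; rewrite jnorm_lin, Rabs_R0; simpl; lra.
- rewrite S_INR; simpl jsum; apply Rle_trans with (1 := jnorm_add _ _).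
  specialize (IH (fun k Hk => H k (Nat.lt_lt_succ_r _ _ Hk))).
  specialize (H n (Nat.lt_succ_diag_r n)); lra.
Qed.

(** Sums [gs_wz] over k < n; the lower boundary term is zero because the certificate has the factor
    [k]. *)
Lemma gs_telescope (q b v : R) (m n : nat) :
  jsum (gs_term q b v m) n =
  (gs_quot q b v m * jsum (gs_term q b v (S m)) n + gs_cert q b v m n)%J.
Proof.
induction n as [| n IH]; simpl jsum.
- unfold gs_cert; rewrite Rmult_0_r; ring.
- rewrite IH.
  transitivity (gs_quot q b v m * jsum (gs_term q b v (S m)) n
    + gs_quot q b v m * gs_term q b v (S m) n
    + gs_cert q b v m n
    + (gs_term q b v m n - gs_quot q b v m * gs_term q b v (S m) n))%J; [ring |].
  rewrite gs_wz; ring.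
Qed.

Lemma gs_telescope_iter (q b v : R) (m n : nat) :
  jsum (gs_term q b v 0) n =
  (jprod (gs_quot q b v) m * jsum (gs_term q b v m) n
   + jsum (fun i => jprod (gs_quot q b v) i * gs_cert q b v i n) m)%J.
Proof.
induction m as [| m IH]; simpl; [ring |].
rewrite IH, (gs_telescope q b v m n); ring.
Qed.

(** Keeps every coefficient of s in the summand and the certificate within 1/2 in absolute value,
    well below the constant terms of the inverted factors. Homogeneity lifts the restriction in
    [gs_series]. *)
Definition small_direction (q b v : R) : Prop :=
  Rabs q <= / 8 /\ Rabs b <= / 8 /\ Rabs v <= / 8.

Ltac small_abs :=
  match goal with H : small_direction _ _ _ |- _ =>
    let H1 := fresh in let H2 := fresh in let H3 := fresh in
    destruct H as [H1 [H2 H3]];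
    apply Rabs_le_between in H1; apply Rabs_le_between in H2;
    apply Rabs_le_between in H3; apply Rabs_le_between; lra
  end.

Lemma gs_ratio_norm (q b v : R) (m k : nat) : small_direction q b v ->
  jnorm (gs_ratio q b v m k) <=
  (4 * INR m + 2 * INR k + 3 + / 2)
  * ((2 * INR k + 1 + / 2) * (2 * INR k + 1 + / 2) * (2 * INR k + 1 + / 2))
  * (/ (2 * INR k + 2 - 0) * / (4 * INR m + 4 * INR k + 6 - / 2)
     * / (4 * INR m + 4 * INR k + 6 - / 2)
     * / (4 * INR m + 2 * INR k + 3 - / 2)).
Proof.
intros H; pose proof (pos_INR m); pose proof (pos_INR k).
unfold gs_ratio.
repeat apply jnorm_mul_le;
  try (apply jnorm_lin_le; [lra | small_abs]);
  apply jnorm_inv_le; try lra; try small_abs.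
Qed.

(** Pairing each numerator factor with a denominator factor gives quotients at most 2, 1, 1/2 and
    1/2. The terms thus decay geometrically, uniformly in [m]. *)
Lemma gs_ratio_norm_half (q b v : R) (m k : nat) : small_direction q b v ->
  jnorm (gs_ratio q b v m k) <= / 2.
Proof.
intros H; pose proof (pos_INR m) as Hm; pose proof (pos_INR k) as Hk.
apply Rle_trans with (1 := gs_ratio_norm q b v m k H).
set (x := 4 * INR m + 2 * INR k + 3); set (y := 4 * INR m + 4 * INR k + 6);
set (z := 2 * INR k + 2).
replace (2 * INR k + 1 + / 2) with (z - / 2) by (unfold z; lra).
assert (Hx : 3 <= x) by (unfold x; lra).
assert (Hz : 2 <= z) by (unfold z; lra).
assert (Hy : 2 * z <= y - / 2) by (unfold y, z; lra).
replace ((x + / 2) * ((z - / 2) * (z - / 2) * (z - / 2))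
  * (/ (z - 0) * / (y - / 2) * / (y - / 2) * / (x - / 2)))
  with (((x + / 2) / (x - / 2)) * ((z - / 2) / z)
        * (((z - / 2) / (y - / 2)) * ((z - / 2) / (y - / 2)))) by (field; lra).
assert (A1 : 0 <= (x + / 2) / (x - / 2) <= 2).
{ split; [apply Rdiv_le_0_compat; lra | apply Rle_div_l; lra]. }
assert (A2 : 0 <= (z - / 2) / z <= 1).
{ split; [apply Rdiv_le_0_compat; lra | apply Rle_div_l; lra]. }
assert (A3 : 0 <= (z - / 2) / (y - / 2) <= / 2).
{ split; [apply Rdiv_le_0_compat; lra | apply Rle_div_l; lra]. }
apply Rle_trans with (2 * 1 * (/ 2 * / 2)); [| lra].
apply Rmult_le_compat; try (apply Rmult_le_pos; lra);
  apply Rmult_le_compat; lra.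
Qed.

(** The decay in [m] comes from this first step alone: it makes all terms with k >= 1 of order
    [/ (m + 1)]. *)
Lemma gs_ratio_norm_first (q b v : R) (m : nat) : small_direction q b v ->
  jnorm (gs_ratio q b v m 0) <= / (2 * (INR m + 1)).
Proof.
intros H; pose proof (pos_INR m) as Hm.
apply Rle_trans with (1 := gs_ratio_norm q b v m 0 H); simpl (INR 0).
set (x := INR m) in *.
match goal with |- ?u <= _ =>
  replace u with ((4 * x + 7 / 2) * (27 / 8)
    / (2 * (4 * x + 11 / 2) ^ 2 * (4 * x + 5 / 2))) by (field; lra)
end.
apply Rle_div_l; [repeat apply Rmult_lt_0_compat; try lra; apply pow_lt; lra |].
rewrite (Rmult_comm (/ _)); apply (Rle_div_r _ _ (2 * (x + 1))); [lra |].
assert (0 <= x ^ 2) by (apply pow_le; lra).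
assert (0 <= x ^ 3) by (apply pow_le; lra).
simpl pow in *; lra.
Qed.

Lemma gs_core_norm (q b v : R) (m k : nat) : small_direction q b v ->
  jnorm (gs_core q b v m k) <= / (4 * INR m + 3 - / 2) * (/ 2) ^ k.
Proof.
intros H; pose proof (pos_INR m) as Hm.
induction k as [| k IH]; simpl gs_core.
- rewrite pow_O, Rmult_1_r; apply jnorm_inv_le; [small_abs | lra].
- simpl pow; rewrite (Rmult_comm (/ 2)), <- Rmult_assoc.
  apply jnorm_mul_le; [exact IH | apply gs_ratio_norm_half, H].
Qed.

Lemma gs_core_norm_succ (q b v : R) (m k : nat) : small_direction q b v ->
  jnorm (gs_core q b v m (S k))
  <= / (4 * INR m + 3 - / 2) * / (2 * (INR m + 1)) * (/ 2) ^ k.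
Proof.
intros H; pose proof (pos_INR m) as Hm.
induction k as [| k IH].
- rewrite pow_O, Rmult_1_r; simpl gs_core; apply jnorm_mul_le.
  + apply jnorm_inv_le; [small_abs | lra].
  + apply gs_ratio_norm_first, H.
- change (gs_core q b v m (S (S k)))
    with (gs_core q b v m (S k) * gs_ratio q b v m (S k))%J.
  simpl pow; rewrite (Rmult_comm (/ 2)), <- Rmult_assoc.
  apply jnorm_mul_le; [exact IH | apply gs_ratio_norm_half, H].
Qed.

Lemma gs_term_norm_succ (q b v : R) (m k : nat) : small_direction q b v ->
  jnorm (gs_term q b v m (S k))
  <= / (INR m + 1) * ((2 + 3 * INR (S k)) * (/ 2) ^ (S k)).
Proof.
intros H; pose proof (pos_INR m) as Hm; pose proof (pos_INR k) as Hk.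
unfold gs_term.
eapply Rle_trans.
- apply jnorm_mul_le; [apply gs_core_norm_succ, H |].
  apply jnorm_lin_le with (e := / 2); [| small_abs].
  rewrite S_INR; lra.
- rewrite S_INR; simpl pow; set (p := (/ 2) ^ k).
  assert (Hp : 0 <= p) by (apply pow_le; lra).
  replace (/ (4 * INR m + 3 - / 2) * / (2 * (INR m + 1)) * p
    * (4 * INR m + 6 * (INR k + 1) + 3 + / 2))
    with (/ (INR m + 1) * ((4 * INR m + 6 * (INR k + 1) + 3 + / 2)
      / (4 * INR m + 3 - / 2) * (/ 2 * p))) by (field; lra).
  apply Rmult_le_compat_l; [apply Rlt_le, Rinv_0_lt_compat; lra |].
  apply Rmult_le_compat_r; [lra |].
  apply Rle_div_l; [lra |]; nra.
Qed.

Lemma gs_term_0 (q b v : R) (m : nat) : gs_term q b v m 0 = jconst 1.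
Proof.
pose proof (pos_INR m).
unfold gs_term; simpl gs_core; simpl (INR 0).
replace (4 * INR m + 6 * 0 + 3) with (4 * INR m + 3) by ring.
rewrite <- (jlin_inv_pos (4 * INR m + 3) q) by lra; ring.
Qed.

(** The bracket is the closed form of the sum of (2 + 3k) / 2^k over 1 <= k <= n. Hence the
    remaining sum tends to 1 as m -> oo, uniformly in [n]. *)
Lemma gs_sum_norm (q b v : R) (m n : nat) : small_direction q b v ->
  jnorm (jsum (gs_term q b v m) (S n) - jconst 1)
  <= / (INR m + 1) * (8 - (8 + 3 * INR n) * (/ 2) ^ n).
Proof.
intros H; pose proof (pos_INR m) as Hm.
induction n as [| n IH].
- simpl jsum; rewrite gs_term_0.
  replace (jconst 0 + jconst 1 - jconst 1)%J with (jconst 0) by ring.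
  unfold jconst; rewrite jnorm_lin, Rabs_R0; simpl; lra.
- change (jsum (gs_term q b v m) (S (S n)))
    with (jsum (gs_term q b v m) (S n) + gs_term q b v m (S n))%J.
  replace (jsum (gs_term q b v m) (S n) + gs_term q b v m (S n) - jconst 1)%J
    with ((jsum (gs_term q b v m) (S n) - jconst 1) + gs_term q b v m (S n))%J
    by ring.
  apply Rle_trans with (1 := jnorm_add _ _).
  pose proof (gs_term_norm_succ q b v m n H) as T.
  eapply Rle_trans; [apply (Rplus_le_compat _ _ _ _ IH T) |].
  rewrite S_INR; simpl pow; right; field; lra.
Qed.

Lemma gs_cert_norm (q b v : R) (m n : nat) : small_direction q b v ->
  jnorm (gs_cert q b v m n) <= 8 * INR n * (/ 2) ^ n.
Proof.
intros H; pose proof (pos_INR m) as Hm; pose proof (pos_INR n) as Hn.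
unfold gs_cert.
eapply Rle_trans.
- repeat apply jnorm_mul_le.
  + unfold jconst; rewrite jnorm_lin, Rabs_R0, Rplus_0_r, Rabs_mult.
    rewrite (Rabs_left (- 8)), (Rabs_pos_eq (INR n)) by lra; apply Rle_refl.
  + apply gs_core_norm, H.
  + apply jnorm_lin_le with (e := / 2); [lra | small_abs].
  + apply jnorm_inv_le with (e := / 2); [small_abs | lra].
- set (p := (/ 2) ^ n).
  assert (Hp : 0 <= p) by (apply pow_le; lra).
  set (x := 4 * INR m + 3); set (y := 4 * INR m + 2 * INR n + 3).
  assert (Hx : 3 <= x) by (unfold x; lra).
  assert (Hy : 3 <= y) by (unfold y; lra).
  replace (- - 8 * INR n * (/ (x - / 2) * p) * (y + / 2) * / (y - / 2))
    with ((8 * INR n * p) * (/ (x - / 2) * ((y + / 2) / (y - / 2))))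
    by (field; lra).
  rewrite <- (Rmult_1_r (8 * INR n * p)) at 2.
  apply Rmult_le_compat_l; [apply Rmult_le_pos; lra |].
  replace 1 with (/ 2 * 2) by lra.
  apply Rmult_le_compat.
  + apply Rlt_le, Rinv_0_lt_compat; lra.
  + apply Rdiv_le_0_compat; lra.
  + apply Rinv_le_contravar; lra.
  + apply Rle_div_l; lra.
Qed.

Lemma cube_le_pow2 (n : nat) : (INR n + 1) ^ 3 <= 32 * 2 ^ n.
Proof.
destruct n as [| [| [| n]]]; [simpl; lra .. |].
induction n as [| n IH]; [simpl; lra |].
pose proof (pos_INR n) as Hn.
rewrite !S_INR in *; simpl pow in *; nra.
Qed.

(** In [gs_telescope_iter] both indices go to infinity together: the product tends to [l], the
    remaining sum to 1, and the accumulated boundary terms to 0. *)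
Theorem gs_sum_limit (q b v : R) (l : jet) : small_direction q b v ->
  jlim (jprod (gs_quot q b v)) l -> jlim (jsum (gs_term q b v 0)) l.
Proof.
intros H Hl; unfold jlim in *.
set (P := jprod (gs_quot q b v)) in *.
(* A convergent sequence is bounded; [K] controls all partial products at once. *)
assert (HP : exists K, 0 <= K /\ forall n, jnorm (P n) <= K).
{ destruct (filterlim_bounded (K := R_AbsRing) (V := R_NormedModule)
    (fun n => jnorm (P n - l))) as [M HM].
  { exists 0; exact Hl. }
  assert (HM' : forall n, jnorm (P n - l) <= M).
  { intros n; specialize (HM n); apply Rle_trans with (2 := HM).
    apply Rle_abs. }
  exists (M + jnorm l); split.
  - pose proof (HM' 0%nat); pose proof (jnorm_pos (P 0%nat - l));
    pose proof (jnorm_pos l); lra.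
  - intros n; replace (P n) with ((P n - l) + l)%J by ring.
    apply Rle_trans with (1 := jnorm_add _ _); specialize (HM' n); lra. }
destruct HP as [K [HK0 HK]].
apply is_lim_seq_incr_1.
apply is_lim_seq_le_le with (fun _ => 0)
  (fun n => jnorm (P (S n) - l) + (8 * K + 512 * K) / (INR n + 1)).
- intros n; split; [apply jnorm_pos |].
  pose proof (pos_INR n) as Hn.
  rewrite (gs_telescope_iter q b v (S n) (S n)); fold P.
  set (s := jsum (gs_term q b v (S n)) (S n)).
  set (e := jsum (fun i => P i * gs_cert q b v i (S n))%J (S n)).
  replace (P (S n) * s + e - l)%J
    with ((P (S n) - l) + (P (S n) * (s - jconst 1) + e))%J by ring.
  apply Rle_trans with (1 := jnorm_add _ _), Rplus_le_compat_l.
  apply Rle_trans with (1 := jnorm_add _ _).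
  replace ((8 * K + 512 * K) / (INR n + 1))
    with (K * (/ (INR n + 1) * 8) + (512 * K) / (INR n + 1)) by (field; lra).
  apply Rplus_le_compat.
  + apply jnorm_mul_le; [apply HK |].
    apply Rle_trans with (1 := gs_sum_norm q b v (S n) n H).
    rewrite S_INR.
    assert (0 <= (8 + 3 * INR n) * (/ 2) ^ n)
      by (apply Rmult_le_pos; [lra | apply pow_le; lra]).
    assert (I : 0 <= / (INR n + 1 + 1) <= / (INR n + 1)).
    { split; [apply Rlt_le, Rinv_0_lt_compat | apply Rinv_le_contravar]; lra. }
    apply Rle_trans with (/ (INR n + 1 + 1) * 8); [apply Rmult_le_compat_l |];
      lra.
  + eapply Rle_trans.
    * apply jnorm_sum_le with (c := K * (8 * INR (S n) * (/ 2) ^ S n)).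
      intros i _; apply jnorm_mul_le; [apply HK | apply gs_cert_norm, H].
    (* There are n + 1 boundary terms, each of order (n + 1) / 2^(n + 1); the cubic bound turns
       their sum into O(1 / (n + 1)). *)
    * pose proof (cube_le_pow2 (S n)) as C.
      rewrite pow_inv; rewrite S_INR in *; set (x := INR n + 1) in *.
      assert (Hx : 1 <= x) by (unfold x; lra).
      set (p := 2 ^ S n) in *.
      assert (Hp : 0 < p) by (apply pow_lt; lra).
      replace (x * (K * (8 * x * / p))) with (K * ((8 * x ^ 2) / p)) by (field; lra).
      replace (512 * K / x) with (K * (512 / x)) by (field; lra).
      apply Rmult_le_compat_l; [exact HK0 |].
      apply Rle_div_l; [exact Hp |].
      apply Rmult_le_reg_r with x; [lra |].
      replace (512 / x * p * x) with (512 * p) by (field; lra).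
      nra.
- apply is_lim_seq_const.
- replace (Finite 0) with (Rbar_plus 0 0) by (simpl; f_equal; ring).
  apply is_lim_seq_plus'; [| apply is_lim_seq_inv_succ].
  apply is_lim_seq_incr_1 with (u := fun n => jnorm (P n - l)); exact Hl.
Qed.

(** * Closed forms in exponential form *)

(* The jet exp(l 1 s + l 2 s^2 + ... + l 5 s^5). *)
Definition jexp (l : nat -> R) : jet :=
  Jet 1 (l 1%nat)
      (l 2%nat + l 1%nat ^ 2 / 2)
      (l 3%nat + l 1%nat * l 2%nat + l 1%nat ^ 3 / 6)
      (l 4%nat + l 1%nat * l 3%nat + l 2%nat ^ 2 / 2 + l 1%nat ^ 2 * l 2%nat / 2
       + l 1%nat ^ 4 / 24)
      (l 5%nat + l 1%nat * l 4%nat + l 2%nat * l 3%nat + l 1%nat ^ 2 * l 3%nat / 2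
       + l 1%nat * l 2%nat ^ 2 / 2 + l 1%nat ^ 3 * l 2%nat / 6
       + l 1%nat ^ 5 / 120).

(** The Taylor coefficients of ln(1 + s); [log_coef x c] below gives those of ln(1 + c s / x). *)
Definition log_sign (j : nat) : R := - (-1) ^ j / INR j.

Definition log_coef (x c : R) (j : nat) : R := log_sign j * (c ^ j * (/ x) ^ j).

Lemma jexp_ext (l l' : nat -> R) :
  (forall j, (1 <= j)%nat -> l j = l' j) -> jexp l = jexp l'.
Proof. intros H; unfold jexp; rewrite !H by lia; reflexivity. Qed.

Lemma jexp_add (l l' : nat -> R) :
  (jexp l * jexp l')%J = jexp (fun j => l j + l' j).
Proof. apply jet_ext; simpl; field. Qed.

Lemma jlin_exp (x c : R) : x <> 0 ->
  jlin x c = (jconst x * jexp (log_coef x c))%J.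
Proof.
intros Hx; apply jet_ext; unfold log_coef, log_sign; simpl; field; assumption.
Qed.

Lemma jinv_exp (x c : R) : x <> 0 ->
  jinv x c = (jconst (/ x) * jexp (fun j => - log_coef x c j)%R)%J.
Proof.
intros Hx; apply jet_ext; unfold log_coef, log_sign; simpl; field; assumption.
Qed.

Lemma jconst_exp_mul (x y : R) (l l' : nat -> R) :
  (jconst x * jexp l * (jconst y * jexp l'))%J =
  (jconst (x * y) * jexp (fun j => l j + l' j)%R)%J.
Proof. rewrite <- jexp_add, jconst_mul; ring. Qed.

(* Supplies the factors with odd number 1, missing from the products over
   3, 5, 7, ..., so that the logarithms involve full sums [tsum j]. *)
Definition gs_norm (q b v : R) : jet :=
  (jlin 1 q * jlin 1 (q / 3)
   * (jinv 1 ((q - b) / 2) * jinv 1 ((q + b) / 2) * jinv 1 (q - 2 * v)))%J.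

Definition gs_norm_inv (q b v : R) : jet :=
  (jinv 1 q * jinv 1 (q / 3)
   * (jlin 1 ((q - b) / 2) * jlin 1 ((q + b) / 2) * jlin 1 (q - 2 * v)))%J.

Lemma gs_norm_inv_r (q b v : R) : (gs_norm q b v * gs_norm_inv q b v)%J = jconst 1.
Proof.
unfold gs_norm, gs_norm_inv.
transitivity ((jlin 1 q * jinv 1 q) * (jlin 1 (q / 3) * jinv 1 (q / 3))
  * ((jlin 1 ((q - b) / 2) * jinv 1 ((q - b) / 2))
     * (jlin 1 ((q + b) / 2) * jinv 1 ((q + b) / 2))
     * (jlin 1 (q - 2 * v) * jinv 1 (q - 2 * v))))%J; [ring |].
rewrite !jlin_inv by lra; ring.
Qed.

Ltac jexp_collect :=
  rewrite ?jlin_exp, ?jinv_exp by lra;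
  rewrite ?jconst_exp_mul.

(** The product of the constant terms of [gs_quot]: the quotients (4m + 7) / (4m + 3) telescope, and
    the squares of (2m + 2) / (2m + 3) form Wallis' product. *)
Definition prod_const (n : nat) : R :=
  (4 * INR n + 3) / 3 * cos_moment 0 (2 * n + 1) ^ 2.

(** One summand for each family of factors. Those in q use the odd numbers up to 4n + 3, those in q
    - 2v up to 4n + 1; 4m + 4 contributes [zsum] with (1/4)^j, and 4m + 6 = 2 (2m + 3) contributes
    [tsum] with (1/2)^j. *)
Definition prod_log (q b v : R) (n j : nat) : R :=
  log_sign j
  * (q ^ j * tsum j (2 * n + 2) - (q - 2 * v) ^ j * tsum j (2 * n + 1)
     + ((q + b - 2 * v) ^ j + (q - b - 2 * v) ^ j) * (/ 4) ^ j * zsum j n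
     - ((q + b) ^ j + (q - b) ^ j) * (/ 2) ^ j * tsum j (n + 1)).

Lemma gs_prod_closed_form (q b v : R) (n : nat) :
  (gs_norm q b v * jprod (gs_quot q b v) n)%J =
  (jconst (prod_const n) * jexp (prod_log q b v n))%J.
Proof.
induction n as [| n IH].
- simpl jprod.
  transitivity (gs_norm q b v); [ring |].
  unfold gs_norm; jexp_collect.
  f_equal.
  + unfold prod_const; simpl (2 * 0 + 1)%nat; rewrite cos_moment_0_1.
    f_equal; simpl; field.
  + apply jexp_ext; intros j Hj; unfold prod_log, log_coef.
    simpl (2 * 0 + 2)%nat; simpl (2 * 0 + 1)%nat; simpl (0 + 1)%nat.
    unfold tsum, zsum; cbn [psum]; simpl (2 * 0 + 1)%nat; simpl (2 * 1 + 1)%nat.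
    replace (INR 3) with 3 by (simpl; ring); simpl (INR 1).
    unfold Rdiv; rewrite !Rpow_mult_distr, !pow_inv, !pow1, Rinv_1; ring.
- cbn [jprod].
  transitivity (gs_norm q b v * jprod (gs_quot q b v) n * gs_quot q b v n)%J;
    [ring |].
  rewrite IH; unfold gs_quot; pose proof (pos_INR n) as Hn; jexp_collect.
  f_equal.
  + f_equal; unfold prod_const.
    pose proof (cos_moment_wallis (2 * n + 1)) as W.
    replace (2 * S n + 1)%nat with (S (S (2 * n + 1))) by lia.
    rewrite plus_INR, mult_INR in W; change (INR 2) with 2 in W;
      change (INR 1) with 1 in W.
    replace (cos_moment 0 (S (S (2 * n + 1))))
      with ((2 * INR n + 2) / (2 * INR n + 3) * cos_moment 0 (2 * n + 1)).
    * rewrite S_INR; field; lra.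
    * apply Rmult_eq_reg_l with (2 * INR n + 3); [| lra].
      transitivity ((2 * INR n + 1 + 1) * cos_moment 0 (2 * n + 1)).
      { field; lra. }
      rewrite <- W; f_equal; ring.
  + apply jexp_ext; intros j Hj; unfold prod_log, log_coef.
    replace (2 * S n + 2)%nat with (S (S (2 * n + 2))) by lia.
    replace (2 * S n + 1)%nat with (S (S (2 * n + 1))) by lia.
    replace (S n + 1)%nat with (S (n + 1)) by lia.
    rewrite !tsum_S, zsum_S.
    replace (INR (2 * (2 * n + 2) + 1)) with (4 * INR n + 5)
      by (rewrite !plus_INR, !mult_INR, !plus_INR, !mult_INR; simpl; ring).
    replace (INR (2 * S (2 * n + 2) + 1)) with (4 * INR n + 7)
      by (rewrite !plus_INR, !mult_INR, !S_INR, !plus_INR, !mult_INR; simpl; ring).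
    replace (INR (2 * (2 * n + 1) + 1)) with (4 * INR n + 3)
      by (rewrite !plus_INR, !mult_INR, !plus_INR, !mult_INR; simpl; ring).
    replace (INR (2 * S (2 * n + 1) + 1)) with (4 * INR n + 5)
      by (rewrite !plus_INR, !mult_INR, !S_INR, !plus_INR, !mult_INR; simpl; ring).
    replace (INR (2 * (n + 1) + 1)) with (2 * INR n + 3)
      by (rewrite !plus_INR, !mult_INR, !plus_INR; simpl; ring).
    rewrite S_INR.
    replace (4 * INR n + 4) with (4 * (INR n + 1)) by ring.
    replace (4 * INR n + 6) with (2 * (2 * INR n + 3)) by ring.
    unfold Rdiv; rewrite !(Rinv_mult 4), !(Rinv_mult 2), !(Rpow_mult_distr (/ _)).
    rewrite !pow_inv; ring.
Qed.

(** * Closed form of the summand at a = 3/4 *)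

Definition central_coef (k : nat) : R := Binomial.C (2 * k) k / 16 ^ k.

Lemma central_coef_0 : central_coef 0 = 1.
Proof. unfold central_coef, Binomial.C; simpl; field. Qed.

Lemma central_coef_S (k : nat) :
  central_coef (S k) =
  central_coef k * ((2 * INR k + 1) / (4 * (2 * INR k + 2))).
Proof.
unfold central_coef, Binomial.C.
replace (2 * S k - S k)%nat with (S k) by lia.
replace (2 * k - k)%nat with k by lia.
replace (2 * S k)%nat with (S (S (2 * k))) by lia.
rewrite !fact_simpl, !mult_INR, !S_INR, !mult_INR; change (INR 2) with 2.
pose proof (pos_INR k); pose proof (INR_fact_neq_0 k).
assert (16 ^ k <> 0) by (apply pow_nonzero; lra).
simpl pow; field; repeat split; try assumption; lra.
Qed.

Definition core_const (k : nat) : R := central_coef k / (3 * (2 * INR k + 1) ^ 2).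

(** The numerator factors in b, -b and v run over the odd numbers up to 2k - 1; all others,
    completed by [gs_norm], run up to 2k + 1. *)
Definition core_log (q b v : R) (k j : nat) : R :=
  log_sign j
  * ((q ^ j - ((q - b) / 2) ^ j - ((q + b) / 2) ^ j - (q - 2 * v) ^ j)
       * tsum j (S k)
     + (b ^ j + (- b) ^ j + v ^ j) * tsum j k).

Lemma gs_core_closed_form (q b v : R) (k : nat) :
  (gs_norm q b v * gs_core q b v 0 k)%J =
  (jconst (core_const k) * jexp (core_log q b v k))%J.
Proof.
induction k as [| k IH].
- cbn [gs_core]; unfold gs_norm; simpl (INR 0); rewrite Rmult_0_r, Rplus_0_l.
  jexp_collect.
  f_equal.
  + f_equal; unfold core_const; rewrite central_coef_0; simpl; field.
  + apply jexp_ext; intros j Hj; unfold core_log, log_coef.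
    unfold tsum; cbn [psum]; simpl (2 * 0 + 1)%nat; simpl (INR 1).
    unfold Rdiv; rewrite !Rpow_mult_distr, !pow_inv, !pow1, Rinv_1; ring.
- cbn [gs_core].
  transitivity (gs_norm q b v * gs_core q b v 0 k * gs_ratio q b v 0 k)%J;
    [ring |].
  rewrite IH; unfold gs_ratio; pose proof (pos_INR k) as Hk; simpl (INR 0).
  rewrite Rmult_0_r, !Rplus_0_l.
  jexp_collect.
  f_equal.
  + f_equal; unfold core_const; rewrite central_coef_S, S_INR; field; lra.
  + apply jexp_ext; intros j Hj; unfold core_log, log_coef.
    rewrite !tsum_S.
    replace (INR (2 * k + 1)) with (2 * INR k + 1)
      by (rewrite plus_INR, mult_INR; simpl; ring).
    replace (INR (2 * S k + 1)) with (2 * INR k + 3)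
      by (rewrite plus_INR, mult_INR, (S_INR k); simpl; ring).
    replace (4 * INR k + 6) with (2 * (2 * INR k + 3)) by ring.
    (* The factor [jinv (2 * INR k + 2) 0] is constant in s, so its logarithm contributes [0 ^ j],
       which is 0 as j >= 1. *)
    rewrite (pow_i j) by lia.
    unfold Rdiv; rewrite !(Rinv_mult 2), !Rpow_mult_distr.
    rewrite !pow_inv; ring.
Qed.

(** * Passing to the limit *)

Ltac lim_poly :=
  repeat (assumption ||
    lazymatch goal with
    | |- is_lim_seq (fun _ => ?c) _ => apply is_lim_seq_const
    | |- is_lim_seq (fun n => @?f n + @?g n) (Finite (?a + ?b)) =>
      apply (is_lim_seq_plus' f g a b)
    | |- is_lim_seq (fun n => @?f n - @?g n) (Finite (?a - ?b)) =>
      apply (is_lim_seq_minus' f g a b)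
    | |- is_lim_seq (fun n => @?f n * @?g n) (Finite (?a * ?b)) =>
      apply (is_lim_seq_mult' f g a b)
    end).

Lemma is_lim_seq_inv_linear (a b : R) : 1 <= a -> 1 <= b ->
  is_lim_seq (fun n => / (a * INR n + b)) 0.
Proof.
intros Ha Hb.
apply is_lim_seq_le_le with (fun _ => 0) (fun n => 1 / (INR n + 1)).
- intros n; pose proof (pos_INR n) as Hn.
  assert (INR n + 1 <= a * INR n + b) by nra.
  unfold Rdiv; rewrite Rmult_1_l.
  split; [apply Rlt_le, Rinv_0_lt_compat | apply Rinv_le_contravar]; lra.
- apply is_lim_seq_const.
- apply is_lim_seq_inv_succ.
Qed.

(** Monotonicity squeezes the square of [cos_moment 0 (2 * n + 1)] between its products with the two
    neighbouring moments, which [cos_moment_product] evaluates. *)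
Lemma prod_const_lim : is_lim_seq prod_const (PI / 3).
Proof.
apply is_lim_seq_le_le with
  (fun n => PI / 3 - PI / 12 * / (1 * INR n + 1))
  (fun n => PI / 3 + PI / 6 * / (2 * INR n + 1)).
- intros n; unfold prod_const; pose proof (pos_INR n) as Hn.
  pose proof PI_RGT_0 as Hpi.
  pose proof (cos_moment_product (2 * n)) as P0.
  pose proof (cos_moment_product (2 * n + 1)) as P1.
  pose proof (cos_moment_decr 0 (2 * n)) as D0.
  pose proof (cos_moment_decr 0 (2 * n + 1)) as D1.
  pose proof (cos_moment_0_pos (2 * n + 1)) as C.
  replace (S (2 * n)) with (2 * n + 1)%nat in * by lia.
  rewrite plus_INR, mult_INR in P1; rewrite mult_INR in P0.
  change (INR 2) with 2 in *; change (INR 1) with 1 in *.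
  set (c := cos_moment 0 (2 * n + 1)) in *.
  set (x := INR n) in *.
  assert (U : c ^ 2 <= PI / 2 / (2 * x + 1)).
  { apply (Rle_div_r _ _ (2 * x + 1)); [lra |].
    rewrite <- P0; replace (c ^ 2 * (2 * x + 1)) with ((2 * x + 1) * (c * c)) by ring.
    apply Rmult_le_compat_l; [lra | apply Rmult_le_compat_r; lra]. }
  assert (M : PI / 2 / (2 * x + 2) <= c ^ 2).
  { apply Rle_div_l; [lra |].
    rewrite <- P1; replace (c ^ 2 * (2 * x + 2)) with ((2 * x + 1 + 1) * (c * c)) by ring.
    apply Rmult_le_compat_l; [lra | apply Rmult_le_compat_l; lra]. }
  split.
  + replace (PI / 3 - PI / 12 * / (1 * x + 1))
      with ((4 * x + 3) / 3 * (PI / 2 / (2 * x + 2))) by (field; lra).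
    apply Rmult_le_compat_l; lra.
  + replace (PI / 3 + PI / 6 * / (2 * x + 1))
      with ((4 * x + 3) / 3 * (PI / 2 / (2 * x + 1))) by (field; lra).
    apply Rmult_le_compat_l; lra.
- replace (Finite (PI / 3)) with (Finite (PI / 3 - PI / 12 * 0)) by (f_equal; ring).
  apply is_lim_seq_minus'; [apply is_lim_seq_const |].
  apply is_lim_seq_mult'; [apply is_lim_seq_const |].
  apply is_lim_seq_inv_linear; lra.
- replace (Finite (PI / 3)) with (Finite (PI / 3 + PI / 6 * 0)) by (f_equal; ring).
  apply is_lim_seq_plus'; [apply is_lim_seq_const |].
  apply is_lim_seq_mult'; [apply is_lim_seq_const |].
  apply is_lim_seq_inv_linear; lra.
Qed.

(** The case j = 1 is separate because the harmonic sums diverge individually; only their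
    combination converges, to a multiple of [lam]. *)
Definition lim_log (lam q b v : R) (j : nat) : R :=
  match j with
  | 1%nat => (3 * v - q) * lam
  | _ =>
    log_sign j
    * (q ^ j * ((1 - / 2 ^ j) * zeta j) - (q - 2 * v) ^ j * ((1 - / 2 ^ j) * zeta j)
       + ((q + b - 2 * v) ^ j + (q - b - 2 * v) ^ j) * (/ 4) ^ j * zeta j
       - ((q + b) ^ j + (q - b) ^ j) * (/ 2) ^ j * ((1 - / 2 ^ j) * zeta j))
  end.

Lemma prod_log_lim_1 (lam q b v : R) :
  is_lim_seq (fun n => tsum 1 n - zsum 1 n / 2) lam ->
  is_lim_seq (fun n => prod_log q b v n 1) ((3 * v - q) * lam).
Proof.
intros H.
set (d := fun n => tsum 1 n - zsum 1 n / 2) in H.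
(* [zsum_double] rewrites the divergent sums through [d] at 2n and n; the three inverses are the
   excess terms of the [tsum]s and tend to 0. *)
apply is_lim_seq_ext with (fun n => 2 * v * d (2 * n)%nat + (v - q) * d n
  + (q * / (4 * INR n + 3) + 2 * v * / (4 * INR n + 1) - q * / (2 * INR n + 1))).
- intros n; unfold prod_log, log_sign, d.
  replace (2 * n + 2)%nat with (S (S (2 * n))) by lia.
  replace (2 * n + 1)%nat with (S (2 * n)) by lia.
  replace (n + 1)%nat with (S n) by lia.
  rewrite !tsum_S, zsum_double.
  replace (INR (2 * (2 * n) + 1)) with (4 * INR n + 1)
    by (rewrite !plus_INR, !mult_INR; simpl; ring).
  replace (INR (2 * S (2 * n) + 1)) with (4 * INR n + 3)
    by (rewrite plus_INR, mult_INR, (S_INR (2 * n)), mult_INR; simpl; ring).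
  replace (INR (2 * n + 1)) with (2 * INR n + 1)
    by (rewrite plus_INR, mult_INR; simpl; ring).
  pose proof (pos_INR n); simpl; field; lra.
- replace ((3 * v - q) * lam)
    with (2 * v * lam + (v - q) * lam + (q * 0 + 2 * v * 0 - q * 0)) by ring.
  pose proof (is_lim_seq_shift d (fun n => (2 * n)%nat) lam
    ltac:(intros; cbv beta; lia) H).
  lim_poly; apply is_lim_seq_inv_linear; lra.
Qed.

Lemma prod_log_lim (lam q b v : R) (j : nat) : (1 <= j)%nat ->
  is_lim_seq (fun n => tsum 1 n - zsum 1 n / 2) lam ->
  is_lim_seq (fun n => prod_log q b v n j) (lim_log lam q b v j).
Proof.
intros Hj H; destruct j as [| [| j]]; [lia | apply prod_log_lim_1, H |].
unfold prod_log, lim_log; set (i := S (S j)).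
assert (Hi : (2 <= i)%nat) by (unfold i; lia).
pose proof (tsum_lim i Hi) as T; pose proof (zsum_lim i Hi) as Z.
pose proof (is_lim_seq_shift _ (fun n => (2 * n + 2)%nat) _
  ltac:(intros; cbv beta; lia) T).
pose proof (is_lim_seq_shift _ (fun n => (2 * n + 1)%nat) _
  ltac:(intros; cbv beta; lia) T).
pose proof (is_lim_seq_shift _ (fun n => (n + 1)%nat) _
  ltac:(intros; cbv beta; lia) T).
lim_poly.
Qed.

Lemma jlim_exp (c : nat -> R) (c' : R) (l : nat -> nat -> R) (l' : nat -> R) :
  is_lim_seq c c' ->
  (forall j, (1 <= j)%nat -> is_lim_seq (fun n => l n j) (l' j)) ->
  jlim (fun n => jconst (c n) * jexp (l n))%J (jconst c' * jexp l')%J.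
Proof.
intros Hc H.
pose proof (H 1%nat ltac:(lia)) as H1; pose proof (H 2%nat ltac:(lia)) as H2;
pose proof (H 3%nat ltac:(lia)) as H3; pose proof (H 4%nat ltac:(lia)) as H4;
pose proof (H 5%nat ltac:(lia)) as H5; clear H.
assert (A : forall u w : nat -> R, forall a : R,
  is_lim_seq u a -> (forall n, w n = Rabs (u n + - a)) -> is_lim_seq w 0).
{ intros u w a Hu Hw; apply is_lim_seq_ext with (fun n => Rabs (u n - a)).
  { intros n; symmetry; apply Hw. }
  replace (Finite 0) with (Finite (Rabs (a - a)))
    by (f_equal; rewrite Rminus_diag; apply Rabs_R0).
  apply (is_lim_seq_abs _ (Finite (a - a))).
  apply is_lim_seq_minus'; [exact Hu | apply is_lim_seq_const]. }
unfold jlim, jnorm.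
replace (Finite 0) with (Finite (0 + 0 + 0 + 0 + 0 + 0)) by (f_equal; ring).
repeat apply is_lim_seq_plus';
  (eapply A; [| intros n; simpl; reflexivity]); unfold Rdiv;
  lim_poly.
Qed.

Lemma jlim_mul_l (a l : jet) (u : nat -> jet) :
  jlim u l -> jlim (fun n => a * u n)%J (a * l)%J.
Proof.
intros H; unfold jlim.
apply is_lim_seq_le_le with (fun _ => 0) (fun n => jnorm a * jnorm (u n - l)).
- intros n; split; [apply jnorm_pos |].
  replace (a * u n - a * l)%J with (a * (u n - l))%J by ring.
  apply jnorm_mul.
- apply is_lim_seq_const.
- replace (Finite 0) with (Rbar_mult (jnorm a) 0) by (simpl; f_equal; ring).
  apply is_lim_seq_scal_l, H.
Qed.

Lemma jlim_ext (u w : nat -> jet) (l : jet) :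
  (forall n, u n = w n) -> jlim u l -> jlim w l.
Proof.
intros E H; apply is_lim_seq_ext with (2 := H); intros n; rewrite E; reflexivity.
Qed.

Lemma jlim_j5 (u : nat -> jet) (l : jet) :
  jlim u l -> is_lim_seq (fun n => j5 (u n)) (j5 l).
Proof.
intros H.
apply is_lim_seq_ext with (fun n => (j5 (u n) - j5 l) + j5 l).
{ intros n; ring. }
replace (Finite (j5 l)) with (Finite (0 + j5 l)) by (f_equal; ring).
apply is_lim_seq_plus'; [| apply is_lim_seq_const].
apply is_lim_seq_abs_0.
apply is_lim_seq_le_le with (fun _ => 0) (fun n => jnorm (u n - l)).
- intros n; split; [apply Rabs_pos |]; unfold jnorm; simpl.
  pose proof (Rabs_pos (j0 (u n) + - j0 l)); pose proof (Rabs_pos (j1 (u n) + - j1 l));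
  pose proof (Rabs_pos (j2 (u n) + - j2 l)); pose proof (Rabs_pos (j3 (u n) + - j3 l));
  pose proof (Rabs_pos (j4 (u n) + - j4 l)); unfold Rminus; lra.
- apply is_lim_seq_const.
- exact H.
Qed.

(** The coefficient of s^5 in [gs_norm q b v * gs_term q b v 0 k]. *)
Definition gs_coef5 (q b v : R) (k : nat) : R :=
  core_const k
  * j5 (jexp (core_log q b v k) * jlin (6 * INR k + 3) q).

(** Closed forms are available only after multiplication by [gs_norm]. This unit is divided out to
    apply [gs_sum_limit] and multiplied back before reading off s^5. *)
Lemma gs_series_small (lam q b v : R) :
  is_lim_seq (fun n => tsum 1 n - zsum 1 n / 2) lam ->
  small_direction q b v ->
  is_series (gs_coef5 q b v) (PI / 3 * j5 (jexp (lim_log lam q b v))).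
Proof.
intros Hlam Hs.
set (L := (jconst (PI / 3) * jexp (lim_log lam q b v))%J).
assert (H0 : jlim (fun n => gs_norm q b v * jprod (gs_quot q b v) n)%J L).
{ apply jlim_ext with (fun n => jconst (prod_const n) * jexp (prod_log q b v n))%J.
  { intros n; symmetry; apply gs_prod_closed_form. }
  apply jlim_exp; [apply prod_const_lim |].
  intros j Hj; apply prod_log_lim; assumption. }
assert (H1 : jlim (jprod (gs_quot q b v)) (gs_norm_inv q b v * L)%J).
{ apply jlim_mul_l with (a := gs_norm_inv q b v) in H0.
  revert H0; apply jlim_ext; intros n.
  transitivity (gs_norm q b v * gs_norm_inv q b v * jprod (gs_quot q b v) n)%J;
    [ring | rewrite gs_norm_inv_r; ring]. }
apply gs_sum_limit in H1; [| exact Hs].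
apply jlim_mul_l with (a := gs_norm q b v) in H1.
replace (gs_norm q b v * (gs_norm_inv q b v * L))%J with L in H1.
2: { transitivity (gs_norm q b v * gs_norm_inv q b v * L)%J;
     [rewrite gs_norm_inv_r |]; ring. }
apply jlim_j5 in H1.
apply is_series_psum.
replace (PI / 3 * j5 (jexp (lim_log lam q b v))) with (j5 L)
  by (unfold L; simpl; ring).
apply is_lim_seq_ext with (2 := H1).
intros n; induction n as [| n IH]; [simpl; ring |].
cbn [psum jsum]; rewrite <- IH.
transitivity (j5 (gs_norm q b v * jsum (gs_term q b v 0) n
  + gs_norm q b v * gs_core q b v 0 n * jlin (4 * INR 0 + 6 * INR n + 3) q)).
{ f_equal; unfold gs_term; ring. }
rewrite gs_core_closed_form.
unfold gs_coef5; simpl (INR 0).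
replace (4 * 0 + 6 * INR n + 3) with (6 * INR n + 3) by ring.
simpl; ring.
Qed.

(** Weighting the j-th logarithmic coefficient by [mu ^ j] amounts to substituting mu s for s. *)
Lemma jexp_scale_5 (mu : R) (l l' : nat -> R) :
  (forall j, (1 <= j)%nat -> l' j = mu ^ j * l j) ->
  j5 (jexp l') = mu ^ 5 * j5 (jexp l).
Proof. intros H; unfold jexp; simpl j5; rewrite !H by lia; field. Qed.

Lemma gs_coef5_scale (mu q b v : R) (k : nat) :
  gs_coef5 (mu * q) (mu * b) (mu * v) k = mu ^ 5 * gs_coef5 q b v k.
Proof.
assert (H : forall j, core_log (mu * q) (mu * b) (mu * v) k j
                      = mu ^ j * core_log q b v k j).
{ intros j; unfold core_log.
  replace ((mu * q - mu * b) / 2) with (mu * ((q - b) / 2)) by field.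
  replace ((mu * q + mu * b) / 2) with (mu * ((q + b) / 2)) by field.
  replace (mu * q - 2 * (mu * v)) with (mu * (q - 2 * v)) by ring.
  replace (- (mu * b)) with (mu * - b) by ring.
  rewrite !Rpow_mult_distr; ring. }
unfold gs_coef5, jexp; simpl j5; rewrite !H; field.
Qed.

Lemma lim_log_scale (mu lam q b v : R) (j : nat) :
  lim_log lam (mu * q) (mu * b) (mu * v) j = mu ^ j * lim_log lam q b v j.
Proof.
assert (E : forall i,
  log_sign i * ((mu * q) ^ i * ((1 - / 2 ^ i) * zeta i)
    - (mu * q - 2 * (mu * v)) ^ i * ((1 - / 2 ^ i) * zeta i)
    + ((mu * q + mu * b - 2 * (mu * v)) ^ i + (mu * q - mu * b - 2 * (mu * v)) ^ i)
      * (/ 4) ^ i * zeta i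
    - ((mu * q + mu * b) ^ i + (mu * q - mu * b) ^ i) * (/ 2) ^ i
      * ((1 - / 2 ^ i) * zeta i))
  = mu ^ i * (log_sign i * (q ^ i * ((1 - / 2 ^ i) * zeta i)
    - (q - 2 * v) ^ i * ((1 - / 2 ^ i) * zeta i)
    + ((q + b - 2 * v) ^ i + (q - b - 2 * v) ^ i) * (/ 4) ^ i * zeta i
    - ((q + b) ^ i + (q - b) ^ i) * (/ 2) ^ i * ((1 - / 2 ^ i) * zeta i)))).
{ intros i.
  replace (mu * q - 2 * (mu * v)) with (mu * (q - 2 * v)) by ring.
  replace (mu * q + mu * b - 2 * (mu * v)) with (mu * (q + b - 2 * v)) by ring.
  replace (mu * q - mu * b - 2 * (mu * v)) with (mu * (q - b - 2 * v)) by ring.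
  replace (mu * q + mu * b) with (mu * (q + b)) by ring.
  replace (mu * q - mu * b) with (mu * (q - b)) by ring.
  rewrite !Rpow_mult_distr; ring. }
destruct j as [| [| j]]; [apply E | simpl; ring | apply E].
Qed.

(** Both sides are homogeneous of degree 5 in the direction, so it can be shrunk until
    [gs_series_small] applies. *)
Lemma gs_series (lam q b v : R) :
  is_lim_seq (fun n => tsum 1 n - zsum 1 n / 2) lam ->
  is_series (gs_coef5 q b v) (PI / 3 * j5 (jexp (lim_log lam q b v))).
Proof.
intros Hlam.
pose proof (Rabs_pos q) as Hq; pose proof (Rabs_pos b) as Hb;
pose proof (Rabs_pos v) as Hv.
(* Dividing by [s] brings each entry below 1/8; the summand 1 keeps [s] positive for the zero
   direction. *)
set (s := 8 * (1 + Rabs q + Rabs b + Rabs v)).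
assert (Hs : 0 < s) by (unfold s; lra).
set (mu := / s).
assert (Hmu : mu <> 0) by (apply Rinv_neq_0_compat; lra).
assert (small : small_direction (mu * q) (mu * b) (mu * v)).
{ assert (B : forall x, Rabs x <= 1 + Rabs q + Rabs b + Rabs v ->
    Rabs (mu * x) <= / 8).
  { intros x Hx; unfold mu; rewrite Rabs_mult, Rabs_inv, (Rabs_pos_eq s) by lra.
    rewrite Rmult_comm; apply (Rle_div_l _ _ s); [exact Hs | unfold s; lra]. }
  repeat split; apply B; lra. }
pose proof (gs_series_small lam _ _ _ Hlam small) as H.
rewrite (jexp_scale_5 mu (lim_log lam q b v)) in H
  by (intros j _; apply lim_log_scale).
apply (is_series_scal_l (/ mu ^ 5)) in H.
assert (mu ^ 5 <> 0) by (apply pow_nonzero, Hmu).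
replace (PI / 3 * j5 (jexp (lim_log lam q b v)))
  with (/ mu ^ 5 * (PI / 3 * (mu ^ 5 * j5 (jexp (lim_log lam q b v)))))
  by (field; assumption).
revert H; apply is_series_ext; intros k.
change (/ mu ^ 5 * gs_coef5 (mu * q) (mu * b) (mu * v) k = gs_coef5 q b v k).
rewrite gs_coef5_scale; field; assumption.
Qed.

(** * The combination of directions *)

Lemma log_sign_values :
  log_sign 1 = 1 /\ log_sign 2 = - / 2 /\ log_sign 3 = / 3
  /\ log_sign 4 = - / 4 /\ log_sign 5 = / 5.
Proof. unfold log_sign; simpl; repeat split; field. Qed.

(* Directions and weights come from solving the linear system that expresses
   33 t3 / x^2 + 8 / x^5 through the polynomials [core_poly]. *)
Definition direction_sum (f : R -> R -> R -> R) : R :=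
  f 3 1 1 + 67 / 20 * f 1 1 2 + -10 * f 1 2 (-1) + -48 * f 0 1 1 + 24 * f 1 1 0
  + / 27 * f 3 0 1 + 666 * f 1 0 0 + -11 / 4 * f 2 2 1 + 357 * f 2 1 0
  + -3 * f 1 0 (-1).

Lemma is_series_axpy (f g : nat -> R) (c s t : R) :
  is_series f s -> is_series g t ->
  is_series (fun k => f k + c * g k) (s + c * t).
Proof.
intros Hf Hg.
apply (is_series_plus (K := R_AbsRing) (V := R_NormedModule) f); [exact Hf |].
apply (is_series_scal (K := R_AbsRing) (V := R_NormedModule)), Hg.
Qed.

Lemma is_series_direction_sum (a : R -> R -> R -> nat -> R) (s : R -> R -> R -> R) :
  (forall q b v, is_series (a q b v) (s q b v)) ->
  is_series (fun k => direction_sum (fun q b v => a q b v k)) (direction_sum s).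
Proof.
intros H; unfold direction_sum.
repeat lazymatch goal with
| |- is_series (fun k => @?f k + ?c * @?g k) (?s + ?c * ?t) =>
  apply (is_series_axpy f g c s t); [| apply H]
end.
apply H.
Qed.

(** Abstracts [core_log] without its sign factor: [t] stands for [tsum j (S k)] and [x] for 2k + 1,
    so that [tsum j k] is [t - 1 / x ^ j]. *)
Definition core_pow (q b v t x : R) (j : nat) : R :=
  (q ^ j - ((q - b) / 2) ^ j - ((q + b) / 2) ^ j - (q - 2 * v) ^ j) * t
  + (b ^ j + (- b) ^ j + v ^ j) * (t - 1 / x ^ j).

(** The coefficient of s^5 in the exponential times 1 + q s / (3x), the factor
    [jlin (6 * INR k + 3) q] divided by its constant term 3x. *)
Definition core_poly (t1 t2 t3 t4 t5 x q b v : R) : R :=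
  let l1 := core_pow q b v t1 x 1 in
  let l2 := - / 2 * core_pow q b v t2 x 2 in
  let l3 := / 3 * core_pow q b v t3 x 3 in
  let l4 := - / 4 * core_pow q b v t4 x 4 in
  let l5 := / 5 * core_pow q b v t5 x 5 in
  (l5 + l1 * l4 + l2 * l3 + l1 ^ 2 * l3 / 2 + l1 * l2 ^ 2 / 2 + l1 ^ 3 * l2 / 6
   + l1 ^ 5 / 120)
  + (l4 + l1 * l3 + l2 ^ 2 / 2 + l1 ^ 2 * l2 / 2 + l1 ^ 4 / 24) * (q / (3 * x)).

Lemma gs_coef5_poly (q b v : R) (k : nat) :
  gs_coef5 q b v k =
  central_coef k / INR (2 * k + 1)
  * core_poly (tsum 1 (S k)) (tsum 2 (S k)) (tsum 3 (S k)) (tsum 4 (S k))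
      (tsum 5 (S k)) (INR (2 * k + 1)) q b v.
Proof.
destruct log_sign_values as [S1 [S2 [S3 [S4 S5]]]].
assert (T : forall j, core_log q b v k j
  = log_sign j * core_pow q b v (tsum j (S k)) (INR (2 * k + 1)) j).
{ intros j; unfold core_log, core_pow; rewrite tsum_S; ring. }
unfold gs_coef5, core_const, core_poly.
unfold jexp, jlin; simpl j5; rewrite !T, S1, S2, S3, S4, S5.
replace (6 * INR k + 3) with (3 * INR (2 * k + 1))
  by (rewrite plus_INR, mult_INR; simpl; ring).
replace (2 * INR k + 1) with (INR (2 * k + 1))
  by (rewrite plus_INR, mult_INR; simpl; ring).
field; apply not_0_INR; lia.
Qed.

(** An identity of rational functions in independent [t1], ..., [t5] and [x]: every monomial except
    [t3 / x ^ 2] and [1 / x ^ 5] cancels. *)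
Lemma direction_sum_core_poly (t1 t2 t3 t4 t5 x : R) : x <> 0 ->
  direction_sum (core_poly t1 t2 t3 t4 t5 x) = (33 * t3 + 8 / x ^ 3) / x ^ 2.
Proof.
intros Hx; unfold direction_sum, core_poly, core_pow.
field; assumption.
Qed.

(** With zeta(2) and zeta(4) written through [PI], all terms in [lam] cancel; the products zeta(2)
    zeta(3) yield the term in [PI ^ 3 * zeta 3]. *)
Lemma direction_sum_lim_log (lam : R) :
  direction_sum (fun q b v => PI / 3 * j5 (jexp (lim_log lam q b v))) =
  245 / 216 * PI ^ 3 * zeta 3 - 49 / 144 * PI * zeta 5.
Proof.
destruct log_sign_values as [S1 [S2 [S3 [S4 S5]]]].
unfold direction_sum, jexp, lim_log; simpl j5.
rewrite S2, S3, S4, S5, zeta_2, zeta_4.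
field.
Qed.

Theorem mainTheorem20 :
  is_series
    (fun k : nat =>
       Binomial.C (2 * k) k / (INR (2 * k + 1) ^ 3 * 16 ^ k) *
       (sum_f_R0 (fun j : nat => 33 / INR (2 * j + 1) ^ 3) k
        + 8 / INR (2 * k + 1) ^ 3))
    (245 / 216 * PI ^ 3 * zeta 3 - 49 / 144 * PI * zeta 5).
Proof.
destruct tsum_1_zsum_1_lim as [lam Hlam].
rewrite <- (direction_sum_lim_log lam).
apply is_series_ext with (fun k => direction_sum (fun q b v => gs_coef5 q b v k)).
- intros k; match goal with |- ?l = ?r => change (@eq R l r) end.
  assert (T : 33 * tsum 3 (S k) = sum_f_R0 (fun j => 33 / INR (2 * j + 1) ^ 3) k).
  { induction k as [| k IH].
    - unfold tsum; simpl; field.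
    - rewrite tsum_S, Rmult_plus_distr_l, IH; cbn [sum_f_R0].
      unfold Rdiv; ring. }
  assert (X : INR (2 * k + 1) <> 0) by (apply not_0_INR; lia).
  rewrite <- T.
  transitivity (central_coef k / INR (2 * k + 1)
    * direction_sum (core_poly (tsum 1 (S k)) (tsum 2 (S k)) (tsum 3 (S k)) (tsum 4 (S k))
        (tsum 5 (S k)) (INR (2 * k + 1)))).
  { unfold direction_sum; rewrite !gs_coef5_poly; ring. }
  rewrite direction_sum_core_poly by exact X; unfold central_coef.
  field; split; [exact X | apply pow_nonzero; lra].
- apply is_series_direction_sum; intros q b v; apply gs_series, Hlam.
Qed.
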